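(* Let $1\leq s,r<\infty$ be such that $1\leq\frac1s+\frac1r$, let $n\in\mathbb{N}$, and let $E_1,\ldots,E_n$ be Banach spaces such that $\mathcal{L}(E_1,\ldots,E_n)$ has the bounded approximation property. Then, for every Banach space $F$, the hyper-Borel transform $$\mathcal{B}_n\colon(\mathcal{HN}_{s,r}(E_1,\ldots,E_n;F),\|\cdot\|_{\mathcal{HN}_{s,r}})^*\longrightarrow\Pi_{s^*,r}(\mathcal{L}(E_1,\ldots,E_n);F^* ),\quad\mathcal{B}_n(\phi)(A)(y)=\phi(A\otimes y),$$ is an isometric isomorphism (onto), where $\frac1s+\frac1{s^*}=1$.
   Context: Banach spaces are over $\mathbb{K}=\mathbb{R}$ or $\mathbb{C}$. $\mathcal{L}(E_1,\ldots,E_n;F)$ is the Banach space of continuous $n$-linear operators with the usual operator norm; $\mathcal{L}(E_1,\ldots,E_n)$ is the case $F=\mathbb{K}$. For $A\in\mathcal{L}(E_1,\ldots,E_n)$, $y\in F$, $(A\otimes y)(x_1,\ldots,x_n)=A(x_1,\ldots,x_n)y$. $\ell_r^w(X)$ is the space of weakly $r$-summable sequences in $X$, with $\|(x_j)_j\|_{w,r}=\sup_{x^*\in B_{X^*}}\left(\sum_j|x^*(x_j)|^r\right)^{1/r}$, and $\ell_\infty(F)$ is the space of bounded sequences in $F$ with the sup norm. $A\in\mathcal{L}(E_1,\ldots,E_n;F)$ is hyper-$(s,r)$-nuclear, $A\in\mathcal{HN}_{s,r}(E_1,\ldots,E_n;F)$, if there are $(\lambda_j)_j\in\ell_s$, $(T_j)_j\in\ell_r^w(\mathcal{L}(E_1,\ldots,E_n))$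 and $(y_j)_j\in\ell_\infty(F)$ with $A(x_1,\ldots,x_n)=\sum_{j=1}^\infty\lambda_jT_j(x_1,\ldots,x_n)y_j$ for all $(x_1,\ldots,x_n)\in E_1\times\cdots\times E_n$. One sets $\|A\|_{\mathcal{HN}_{s,r}}=\inf\|(\lambda_j)_j\|_s\cdot\|(T_j)_j\|_{w,r}\cdot\|(y_j)_j\|_\infty$ over all such representations. The dual space consists of the linear functionals $\phi$ with $\|\phi\|=\sup\{|\phi(A)|:\|A\|_{\mathcal{HN}_{s,r}}\leq1\}<\infty$, with this norm. $\Pi_{q,p}(X;Y)$ ($p\leq q$) is the Banach space of $(q,p)$-summing linear operators $u\colon X\to Y$, i.e. those for which there is $C\geq0$ with $\left(\sum_{j=1}^m\|u(x_j)\|^q\right)^{1/q}\leq C\|(x_j)_{j=1}^m\|_{w,p}$ for all $m$ and $x_1,\ldots,x_m\in X$; its norm is the least such $C$. For $q=\infty$ (the case $s=1$) the left-hand side is read as $\max_j\|u(x_j)\|$. *)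

(* Defs.v *)
From HB Require Import structures.
From mathcomp Require Import all_boot all_order all_algebra.
From mathcomp Require Import complex.
From mathcomp Require Import all_classical all_reals all_analysis.
From mathcomp Require Import ess_sup_inf.

Set Implicit Arguments.
Unset Strict Implicit.
Unset Printing Implicit Defensive.
Import Order.TTheory GRing.Theory Num.Theory.
Import numFieldNormedType.Exports.
Local Open Scope classical_set_scope.
Local Open Scope ring_scope.

Variant base_field := RealScalars | ComplexScalars.

Definition scalars (R : realType) (k : base_field) : numFieldType :=
  match k with
  | RealScalars => R : numFieldType
  | ComplexScalars => R[i] : numFieldType
  end.

Definition to_real (R : realType) (k : base_field) : scalars R k -> R :=
  match k return scalars R k -> R with
  | RealScalars => id
  | ComplexScalars => @complex.Re R
  end.

(* [to_real] is only meant to be used on nonnegative elements, where it is the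
   inverse of [of_real]. *)
Definition of_real (R : realType) (k : base_field) : R -> scalars R k :=
  match k return R -> scalars R k with
  | RealScalars => id
  | ComplexScalars => fun x => (x%:C)%C
  end.
Arguments of_real {R k} x.

Section scalars_theory.
Context {R : realType} {k : base_field}.
Local Notation K := (scalars R k).

Lemma of_realD : {morph (@of_real R k) : x y / x + y}.
Proof. by rewrite /of_real; case: k => //= x y; rewrite rmorphD. Qed.

Lemma of_realM : {morph (@of_real R k) : x y / x * y}.
Proof. by rewrite /of_real; case: k => //= x y; rewrite rmorphM. Qed.

Lemma of_real0 : of_real 0 = 0 :> K.
Proof. by rewrite /of_real; case: k. Qed.

Lemma of_real1 : of_real 1 = 1 :> K.
Proof. by rewrite /of_real; case: k. Qed.

Lemma ler_of_real : {mono (@of_real R k) : x y / x <= y}.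
Proof. by rewrite /of_real; case: k => //= x y; rewrite lecR. Qed.

Lemma of_realK : cancel of_real (@to_real R k).
Proof. by rewrite /to_real /of_real; case: k. Qed.

Lemma ge0_to_realK (x : K) : 0 <= x -> of_real (to_real x) = x.
Proof.
rewrite /to_real /of_real; move: x; case: k => //= x.
by rewrite lecE/= => /andP[/eqP ix _]; apply/eqP; rewrite eq_complex/= ix !eqxx.
Qed.

(* The norm of a normed module over [K] is [K]-valued; [rnorm] is the same
   norm with values in [R]. *)
Definition rnorm (V : normedModType K) (v : V) : R := to_real `|v|.

Section rnorm_theory.
Context {V : normedModType K}.
Implicit Types v w : V.

Lemma of_real_rnorm v : of_real (rnorm v) = `|v|.
Proof. by rewrite ge0_to_realK. Qed.

Lemma rnorm_le v w : (rnorm v <= rnorm w) = (`|v| <= `|w|).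
Proof. by rewrite -ler_of_real !of_real_rnorm. Qed.

Lemma rnorm_ge0 v : 0 <= rnorm v.
Proof. by rewrite -ler_of_real of_real0 of_real_rnorm. Qed.

Lemma rnorm0 : rnorm (0 : V) = 0.
Proof. by rewrite /rnorm normr0 -(of_realK 0) of_real0. Qed.

Lemma rnorm0_eq0 v : rnorm v = 0 -> v = 0.
Proof. by move=> v0; apply/normr0_eq0; rewrite -of_real_rnorm v0 of_real0. Qed.

Lemma ler_rnormD v w : rnorm (v + w) <= rnorm v + rnorm w.
Proof. by rewrite -ler_of_real of_realD !of_real_rnorm ler_normD. Qed.

End rnorm_theory.

Lemma rnormZ (V : normedModType K) (c : K) (v : V) :
  rnorm (c *: v) = rnorm (c : K^o) * rnorm v.
Proof.
rewrite -[LHS]of_realK -[RHS]of_realK; congr to_real.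
by rewrite of_realM !of_real_rnorm normrZ.
Qed.

Section sup_norm.
Context {D : Type} {W : normedModType K} (U : set D).
Hypothesis U0 : U !=set0.
Implicit Types f g : D -> W.

Definition bounded_over f := exists M : R, forall x, U x -> rnorm (f x) <= M.

Definition sup_norm f : R := sup [set rnorm (f x) | x in U].

Lemma sup_norm_ub f x : bounded_over f -> U x -> rnorm (f x) <= sup_norm f.
Proof.
move=> [M fM] Ux; apply: ub_le_sup; last by exists x.
by exists M => _ [y Uy <-]; exact: fM.
Qed.

Lemma sup_norm_le f (M : R) : (forall x, U x -> rnorm (f x) <= M) ->
  sup_norm f <= M.
Proof.
move=> fM; apply: ge_sup; first by case: U0 => x Ux; exists (rnorm (f x)), x.
by move=> _ [y Uy <-]; exact: fM.
Qed.

Lemma sup_norm_ge0 f : bounded_over f -> 0 <= sup_norm f.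
Proof.
move=> fM; case: U0 => x Ux.
exact: le_trans (rnorm_ge0 (f x)) (sup_norm_ub fM Ux).
Qed.

Lemma sup_normD f g : bounded_over f -> bounded_over g ->
  sup_norm (f + g) <= sup_norm f + sup_norm g.
Proof.
move=> bf bg; apply: sup_norm_le => x Ux.
by rewrite (le_trans (ler_rnormD _ _))// lerD// sup_norm_ub.
Qed.

Lemma sup_normZ_le (c : K) f : bounded_over f ->
  sup_norm (c *: f) <= rnorm (c : K^o) * sup_norm f.
Proof.
move=> bf; apply: sup_norm_le => x Ux; rewrite rnormZ ler_wpM2l ?rnorm_ge0//.
exact: sup_norm_ub.
Qed.

Lemma sup_normZ (c : K) f : bounded_over f ->
  sup_norm (c *: f) = rnorm (c : K^o) * sup_norm f.
Proof.
move=> bf; apply/eqP; rewrite eq_le sup_normZ_le//=.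
have bcf : bounded_over (c *: f).
  have [M fM] := bf; exists (rnorm (c : K^o) * M) => x Ux.
  by rewrite rnormZ ler_wpM2l ?rnorm_ge0// fM.
have [->|c0] := eqVneq c 0.
  by rewrite (@rnorm0 K^o) mul0r scale0r sup_norm_ge0//; exists 0 => x _; rewrite rnorm0.
have := sup_normZ_le c^-1 bcf.
rewrite scalerA mulVf// scale1r => /(ler_wpM2l (rnorm_ge0 (c : K^o))).
move/le_trans; apply; rewrite mulrA -(@rnormZ K^o) [c *: _]mulfV//.
by rewrite (_ : rnorm _ = 1) ?mul1r// /rnorm normr1 -(of_realK 1) of_real1.
Qed.

End sup_norm.

End scalars_theory.

Section cont_linear.
Context {R : realType} {k : base_field}.
Local Notation K := (scalars R k).
Variables V W : normedModType K.

(* For W := K^o this is the topological dual of V. *)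
Definition cont_linear_pred : {pred V -> W} :=
  mem [set f : V -> W | linear f /\ continuous f].

Record cont_linear := ContLinear {
  cont_linear_fun :> V -> W;
  _ : cont_linear_fun \in cont_linear_pred }.

HB.instance Definition _ := [isSub for cont_linear_fun].
HB.instance Definition _ := [Choice of cont_linear by <:].

Lemma cont_linear_submod_closed : submod_closed cont_linear_pred.
Proof.
split=> [|c f g /set_mem[lf cf] /set_mem[lg cg]]; apply/mem_set.
  split; last by move=> x; exact: cvg_cst.
  by move=> a x y; rewrite [RHS]addr0 [RHS]scaler0.
split=> [a x y|x].
  rewrite -[LHS]/(c *: f (a *: x + y) + g (a *: x + y)).
  rewrite -[RHS]/(a *: (c *: f x + g x) + (c *: f y + g y)) lf lg !scalerDr !scalerA (mulrC c a) -!addrA.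
  by congr (_ + _); rewrite addrCA.
by apply: cvgD; [apply: cvgZl_tmp; exact: cf|exact: cg].
Qed.

HB.instance Definition _ :=
  GRing.isSubmodClosed.Build _ _ cont_linear_pred cont_linear_submod_closed.
HB.instance Definition _ := [SubChoice_isSubLmodule of cont_linear by <:].

Lemma cont_linearP (f : cont_linear) : linear f /\ continuous f.
Proof. exact: set_mem (valP f). Qed.

Definition unit_ball : set V := [set x | `|x| <= 1].

Lemma unit_ball0 : unit_ball !=set0.
Proof. by exists 0; rewrite /unit_ball/= normr0. Qed.

Let lin (f : cont_linear) : {linear V -> W} :=
  HB.pack (f : V -> W) (GRing.isLinear.Build _ _ _ _ _ (cont_linearP f).1).

Lemma cont_linear_bounded (f : cont_linear) : bounded_over unit_ball f.
Proof.
have /linear_boundedP : bounded_near (lin f) (nbhs 0).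
  by apply/linear_bounded_continuous; exact: (cont_linearP f).2.
rewrite /= => /pinfty_ex_gt0[M M0 fM].
exists (to_real M) => x x1.
rewrite -(@ler_of_real R k) of_real_rnorm ge0_to_realK ?(ltW M0)//.
by rewrite (le_trans (fM x))// ler_piMr// ltW.
Qed.

Definition op_norm (f : cont_linear) : R := sup_norm unit_ball f.

Lemma op_normD (f g : cont_linear) :
  of_real (op_norm (f + g)) <= of_real (op_norm f) + of_real (op_norm g) :> K.
Proof.
rewrite -of_realD ler_of_real.
exact: (sup_normD unit_ball0 (cont_linear_bounded f) (cont_linear_bounded g)).
Qed.

Lemma op_normZ (c : K) (f : cont_linear) :
  of_real (op_norm (c *: f)) = `|c| * of_real (op_norm f) :> K.
Proof.
rewrite -(@of_real_rnorm _ _ K^o) -of_realM; congr of_real.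
exact: (sup_normZ unit_ball0 _ (cont_linear_bounded f)).
Qed.

Lemma op_norm0_eq0 (f : cont_linear) : of_real (op_norm f) = 0 :> K -> f = 0.
Proof.
rewrite -of_real0 => /(can_inj of_realK) f0; apply/val_inj/funext => x /=.
have [->|x0] := eqVneq x 0; first exact: (linear0 (lin f)).
have nx0 : `|x| != 0 by rewrite normr_eq0.
have : f (`|x|^-1 *: x) = 0.
  apply/rnorm0_eq0/eqP; rewrite eq_le rnorm_ge0 andbT -f0.
  apply: sup_norm_ub; first exact: cont_linear_bounded.
  by rewrite /unit_ball/= normrZ normfV normr_id mulVf.
rewrite [f _](linearZ_LR (lin f)) => /(congr1 ( *:%R `|x|)).
by rewrite scalerA mulfV// scale1r scaler0.
Qed.

HB.instance Definition _ :=
  Lmodule_isNormed.Build K cont_linear op_normD op_normZ op_norm0_eq0.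

End cont_linear.

Section cont_multilinear.
Context {R : realType} {k : base_field} {n : nat}.
Local Notation K := (scalars R k).
Variables (E : 'I_n -> normedModType K) (W : normedModType K).

Definition multilinear (f : (forall i, E i) -> W) :=
  forall (x : forall i, E i) (i : 'I_n),
    linear (fun v : E i => f (dfwith x i v)).

Definition cont_multilinear_pred : {pred (forall i, E i) -> W} :=
  mem [set f : (forall i, E i) -> W | multilinear f /\
    continuous (f : prod_topology (fun i => E i) -> W)].

Record cont_multilinear := ContMultilinear {
  cont_multilinear_fun :> (forall i, E i) -> W;
  _ : cont_multilinear_fun \in cont_multilinear_pred }.

HB.instance Definition _ := [isSub for cont_multilinear_fun].
HB.instance Definition _ := [Choice of cont_multilinear by <:].

Lemma cont_multilinear_submod_closed : submod_closed cont_multilinear_pred.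
Proof.
split=> [|c f g /set_mem[lf cf] /set_mem[lg cg]]; apply/mem_set.
  split; last exact: (@cst_continuous (prod_topology (fun i => E i)) W 0).
  move=> x i a u v; rewrite -[LHS]/(0 : W) -[RHS]/(a *: 0 + 0 : W).
  by rewrite [RHS]addr0 [RHS]scaler0.
split=> [x i a u v|x].
  have /= := lf x i a u v; have /= := lg x i a u v.
  move: (dfwith x i (a *: u + v)) (dfwith x i u) (dfwith x i v) => w y z gw fw.
  rewrite -[LHS]/(c *: f w + g w).
  rewrite -[RHS]/(a *: (c *: f y + g y) + (c *: f z + g z)) fw gw.
  rewrite !scalerDr !scalerA (mulrC c a) -!addrA.
  by congr (_ + _); rewrite addrCA.
pose P := prod_topology (fun i => E i).
have FF : Filter (nbhs (x : P)) by exact: nbhs_filter.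
exact: (@cvgD _ _ _ _ FF _ _ _ _ (@cvgZl_tmp _ _ _ _ FF c _ _ (cf x)) (cg x)).
Qed.

HB.instance Definition _ := GRing.isSubmodClosed.Build _ _
  cont_multilinear_pred cont_multilinear_submod_closed.
HB.instance Definition _ := [SubChoice_isSubLmodule of cont_multilinear by <:].

Lemma cont_multilinearP (f : cont_multilinear) : multilinear f /\
  continuous (f : prod_topology (fun i => E i) -> W).
Proof. exact: set_mem (valP f). Qed.

Definition unit_polyball : set (forall i, E i) :=
  [set x | forall i, `|x i| <= 1].

Lemma unit_polyball0 : unit_polyball !=set0.
Proof. by exists (fun=> 0) => i; rewrite normr0. Qed.

(* homogeneity of degree [n] *)
Lemma multilinear_scale (f : (forall i, E i) -> W) (c : K) (x : forall i, E i) :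
  multilinear f -> f (fun i => c *: x i) = c ^+ n *: f x.
Proof.
move=> mf; pose xs (s : seq 'I_n) i := if i \in s then c *: x i else x i.
have fxs s : uniq s -> f (xs s) = c ^+ size s *: f x.
  elim: s => [_|i s IH /= /andP[nis us]]; first by rewrite scale1r.
  pose l : {linear E i -> W} := HB.pack (fun v : E i => f (dfwith (xs s) i v))
    (GRing.isLinear.Build _ _ _ _ _ (mf (xs s) i)).
  have -> : xs (i :: s) = dfwith (xs s) i (c *: x i).
    apply: functional_extensionality_dep => j; rewrite /xs in_cons.
    case: dfwithP => [|j' ij']; first by rewrite eqxx.
    by rewrite (negbTE (_ : j' != i)) 1?eq_sym.
  rewrite [LHS](linearZ_LR l c (x i)) /= exprS -scalerA -IH//; congr (_ *: f _).
  apply: functional_extensionality_dep => j.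
  by case: dfwithP => // ; rewrite /xs (negbTE nis).
have := fxs _ (enum_uniq 'I_n); rewrite size_enum_ord => <-; congr f.
by apply: functional_extensionality_dep => j; rewrite /xs mem_enum.
Qed.

Lemma cont_multilinear_bounded (f : cont_multilinear) :
  bounded_over unit_polyball f.
Proof.
have [mf cf] := cont_multilinearP f.
pose P := prod_topology (fun i => E i).
pose G : set_system P :=
  filter_from [set e : K | 0 < e] (fun e => [set x : P | forall i, `|x i| <= e]).
have FG : Filter G.
  apply: filter_from_filter; first by exists 1 => /=.
  move=> a b /= a0 b0; exists (Num.min a b) => [|x /= xab].
    by rewrite comparable_lt_min ?real_comparable ?gtr0_real// a0.
  split=> i; apply: le_trans (xab i) _;
    by rewrite comparable_ge_min ?real_comparable ?gtr0_real// lexx ?orbT.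
have G0 : G --> ((fun=> 0) : P).
  apply/cvg_sup => i U [] /= _ [[B oB <-] /= B0 BU].
  have /nbhs_norm0P[e /= e0 eB] : nbhs (0 : E i) B by exact: open_nbhs_nbhs.
  exists (e / 2) => [/=|x /= xe]; first by rewrite divr_gt0.
  apply: BU; apply: eB => /=; apply: le_lt_trans (xe i) _.
  by rewrite ltr_pdivrMr// ltr_pMr// ltr1n.
have /cvgrPdist_lt /(_ 1 ltr01) [e /= e0 eG] := cvg_trans (cvg_app f G0) (cf _).
set f0 := f (fun=> 0) in eG.
exists (to_real (e ^- n * (1 + `|f0|))) => x x1.
rewrite -(@ler_of_real R k) of_real_rnorm ge0_to_realK; last first.
  by rewrite mulr_ge0// ?invr_ge0 ?exprn_ge0 ?addr_ge0 ?ltW.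
have fe : `|f (fun i => e *: x i)| <= 1 + `|f0|.
  rewrite -lerBlDr; apply: le_trans (lerB_dist _ _) _; rewrite distrC ltW//.
  by apply: eG => i; rewrite normrZ gtr0_norm// ler_piMr ?(ltW e0)//; exact: x1.
have -> : f x = e ^- n *: f (fun i => e *: x i).
  by rewrite multilinear_scale// scalerA mulVf ?scale1r// expf_neq0// gt_eqF.
by rewrite normrZ gtr0_norm ?invr_gt0 ?exprn_gt0// ler_wpM2l// invr_ge0 exprn_ge0// ltW.
Qed.

Definition multi_norm (f : cont_multilinear) : R := sup_norm unit_polyball f.

Lemma multi_normD (f g : cont_multilinear) :
  of_real (multi_norm (f + g)) <=
  of_real (multi_norm f) + of_real (multi_norm g) :> K.
Proof.
rewrite -of_realD ler_of_real.
exact: (sup_normD unit_polyball0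
  (cont_multilinear_bounded f) (cont_multilinear_bounded g)).
Qed.

Lemma multi_normZ (c : K) (f : cont_multilinear) :
  of_real (multi_norm (c *: f)) = `|c| * of_real (multi_norm f) :> K.
Proof.
rewrite -(@of_real_rnorm _ _ K^o) -of_realM; congr of_real.
exact: (sup_normZ unit_polyball0 _ (cont_multilinear_bounded f)).
Qed.

Lemma multi_norm0_eq0 (f : cont_multilinear) :
  of_real (multi_norm f) = 0 :> K -> f = 0.
Proof.
rewrite -of_real0 => /(can_inj of_realK) f0; apply/val_inj/funext => x /=.
have [mf _] := cont_multilinearP f.
pose c : K := 1 + \sum_i `|x i|.
have c0 : 0 < c by rewrite ltr_wpDr// sumr_ge0.
have fx0 : f (fun i => c^-1 *: x i) = 0.
  apply/rnorm0_eq0/eqP; rewrite eq_le rnorm_ge0 andbT -f0.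
  apply: sup_norm_ub; first exact: cont_multilinear_bounded.
  move=> i; rewrite normrZ gtr0_norm ?invr_gt0// ler_pdivrMl// mulr1.
  by rewrite /c (bigD1 i)//= addrCA lerDl addr_ge0// sumr_ge0.
have -> : (x : forall i, E i) = (fun i => c *: (c^-1 *: x i)).
  apply: functional_extensionality_dep => i.
  by rewrite scalerA mulfV ?scale1r// gt_eqF.
by rewrite multilinear_scale// fx0 scaler0.
Qed.

HB.instance Definition _ :=
  Lmodule_isNormed.Build K cont_multilinear multi_normD multi_normZ multi_norm0_eq0.

End cont_multilinear.

(* Two representations are added by interleaving them. *)
Definition interleave {T : Type} (u v : nat -> T) (j : nat) : T :=
  if odd j then v j./2 else u j./2.

Lemma map_interleave {T T' : Type} (g : T -> T') (u v : nat -> T) :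
  (fun j => g (interleave u v j)) =
  interleave (fun j => g (u j)) (fun j => g (v j)).
Proof. by apply/funext => j; rewrite /interleave /=; case: ifP. Qed.

Section sequence_norms.
Context {R : realType}.
Implicit Types (a b : nat -> R) (c p : R).
Local Open Scope ereal_scope.

(* For p = +oo this is the essential supremum for the counting measure, that is,
   the supremum. *)
Definition lnorm (p : \bar R) a : \bar R := 'N[counting]_p[EFin \o a].

Let counting_ae (P : nat -> Prop) : (\forall j \ae (@counting nat R), P j) ->
  forall j, P j.
Proof.
move=> [A [mA A0 PA]] j; apply: contrapT => nPj.
have : counting [set j] <= @counting nat R A.
  by apply: le_measure; rewrite ?inE// => _ ->; exact: PA.
by rewrite A0 /counting asboolT// fset_set1 finmap.cardfs1 lee_fin ler10.
Qed.

Let countingT : 0 < @counting nat R [set: nat].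
Proof. by rewrite /counting asboolF//; exact: infinite_nat. Qed.

Lemma lnormy_lty a : lnorm +oo a < +oo <-> exists M, forall j, (`|a j| <= M)%R.
Proof.
rewrite /lnorm unlock countingT; split=> [|[M aM]]; last first.
  apply: (@le_lt_trans _ _ M%:E); last exact: ltry.
  by apply/ess_supP; apply: nearW => j; rewrite /= lee_fin.
move=> a_fin.
have aE j : (`|a j|)%:E <= ess_sup counting (abse \o (EFin \o a)).
  exact: (counting_ae (ess_sup_ge counting (abse \o (EFin \o a)))).
have fin : ess_sup counting (abse \o (EFin \o a)) \is a fin_num.
  by rewrite ge0_fin_numE// (le_trans _ (aE 0%N)).
by exists (fine (ess_sup counting (abse \o (EFin \o a)))) => j; rewrite -lee_fin fineK.
Qed.

Lemma lnorm_lty p a : p != 0%R ->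
  lnorm p%:E a < +oo <-> \sum_(j <oo) (`|a j| `^ p)%:E < +oo.
Proof.
move=> p0; rewrite /lnorm unlock ge0_integral_count//=.
by split=> [|/poweR_lty//]; apply: lty_poweRy; rewrite invr_eq0.
Qed.

Lemma lnorm0_lty a : lnorm 0%:E a < +oo.
Proof. by rewrite /lnorm unlock invr0 poweRe0 ltry. Qed.

Lemma lnorm_interleave (p : \bar R) a b :  p != -oo ->
  lnorm p a < +oo -> lnorm p b < +oo -> lnorm p (interleave a b) < +oo.
Proof.
case: p => [p _|_|//]; last first.
  move=> /lnormy_lty[M aM] /lnormy_lty[N bN]; apply/lnormy_lty.
  exists (Num.max M N) => j; rewrite /interleave le_max.
  by case: ifP => _; rewrite ?aM ?bN ?orbT.
have [->|p0] := eqVneq p 0%R; first by move=> *; exact: lnorm0_lty.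
move=> /(lnorm_lty _ p0) fa /(lnorm_lty _ p0) fb; apply/lnorm_lty => //.
pose f j := (`|a j| `^ p)%:E; pose g j := (`|b j| `^ p)%:E.
have f0 j : 0 <= f j by rewrite lee_fin powR_ge0.
have g0 j : 0 <= g j by rewrite lee_fin powR_ge0.
rewrite (eq_eseriesr (g := interleave f g)); last first.
  by move=> j _; rewrite /interleave; case: ifP.
have h0 j : 0 <= interleave f g j by rewrite /interleave; case: ifP.
apply: (@le_lt_trans _ _ (\sum_(j <oo) f j + \sum_(j <oo) g j)); last first.
  exact: lte_add_pinfty.
apply: lime_le; first exact: is_cvg_nneseries.
apply: nearW => N.
have even_sum M : \sum_(0 <= j < M.*2) interleave f g j =
    \sum_(0 <= j < M) f j + \sum_(0 <= j < M) g j.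
  elim: M => [|M IH]; first by rewrite !big_nil adde0.
  rewrite doubleS !big_nat_recr//= IH /interleave /= odd_double /= uphalf_double.
  by rewrite doubleK addeACA addeA.
apply: (@le_trans _ _ (\sum_(0 <= j < N.*2) interleave f g j)).
  have NN : (N <= N.*2)%N by rewrite -addnn leq_addr.
  by rewrite (big_cat_nat (leq0n N) NN)/= leeDl// sume_ge0.
by rewrite even_sum leeD// nneseries_lim_ge.
Qed.

Lemma lnormZ_lty (p : \bar R) c a : p != -oo -> lnorm p a < +oo ->
  lnorm p (fun j => (`|c| * a j)%R) < +oo.
Proof.
case: p => [p _|_|//]; last first.
  move=> /lnormy_lty[M aM]; apply/lnormy_lty.
  by exists (`|c| * M)%R => j; rewrite normrM normr_id ler_wpM2l.
have [->|p0] := eqVneq p 0%R; first by move=> *; exact: lnorm0_lty.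
move=> /(lnorm_lty _ p0) fa; apply/lnorm_lty => //.
rewrite (eq_eseriesr (g := fun j => (`|c| `^ p)%:E * (`|a j| `^ p)%:E)); last first.
  by move=> j _; rewrite normrM normr_id powRM// EFinM.
rewrite nneseriesZl; last by move=> j _; rewrite lee_fin powR_ge0.
by rewrite lte_mul_pinfty// lee_fin powR_ge0.
Qed.

Lemma lnorm_single_lty (p : \bar R) c : p != -oo ->
  lnorm p (fun j => if j is 0%N then c else 0%R) < +oo.
Proof.
case: p => [p _|_|//]; last first.
  by apply/lnormy_lty; exists `|c|%R => -[|j]//=; rewrite normr0.
have [->|p0] := eqVneq p 0%R; first exact: lnorm0_lty.
apply/lnorm_lty => //; rewrite (nneseries_split 0 1); last first.
  by move=> *; rewrite lee_fin powR_ge0.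
rewrite big_nat1 eseries0 ?adde0 ?ltry// => -[|j]// _ _.
by rewrite normr0 powR0.
Qed.

End sequence_norms.

Lemma series_interleave (K : numFieldType) (V : normedModType K)
    (u v : nat -> V) (a b : V) :
  series u @ \oo --> a -> series v @ \oo --> b ->
  series (interleave u v) @ \oo --> a + b.
Proof.
move=> ua vb.
have E N : series (interleave u v) N = series u (uphalf N) + series v N./2.
  have seriesS (w : nat -> V) m : series w m.+1 = series w m + w m.
    by rewrite /series/= big_nat_recr.
  elim: N => [|N IH]; first by rewrite /series/= !big_geq// addr0.
  rewrite seriesS IH -[uphalf N.+1]/(N./2.+1) -[(N.+1)./2]/(uphalf N).
  rewrite uphalf_half /interleave; case: (odd N) => /=.
    by rewrite add1n [series v _.+1]seriesS addrA.
  by rewrite add0n [series u _.+1]seriesS addrAC.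
have half_cvg : (fun N : nat => N./2) @ \oo --> \oo.
  move=> P [N _ NP]; exists N.*2 => //= j Nj; apply: NP => /=.
  by rewrite -(doubleK N) half_leq.
have uphalf_cvg : (fun N : nat => uphalf N) @ \oo --> \oo.
  move=> P [N _ NP]; exists N.*2 => //= j Nj; apply: NP => /=.
  by rewrite -(doubleK N) (leq_trans (half_leq Nj))// uphalf_half leq_addl.
rewrite (_ : series (interleave u v) = (series u \o uphalf) + (series v \o half)).
  by apply: cvgD; [exact: cvg_comp ua|exact: cvg_comp vb].
by apply/funext => N; exact: E.
Qed.

Section normed_space_notions.
Context {R : realType} {k : base_field}.
Local Notation K := (scalars R k).
Implicit Types V W : normedModType K.

Definition finite_rank V W (T : V -> W) := exists (m : nat) (w : 'I_m -> W),
  forall x, exists c : 'I_m -> K, T x = \sum_(i < m) c i *: w i.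

Definition bounded_approximation_property V := exists lambda : R,
  forall (Q : set V) (e : R), compact Q -> 0 < e ->
  exists T : cont_linear V V, [/\ finite_rank T, rnorm T <= lambda &
    forall x, Q x -> rnorm (T x - x) <= e].

(* As usual, weak summability only asks for each scalar sequence to be in l_r; that
   the supremum [weak_norm] is then finite is a consequence of the uniform
   boundedness principle. *)
Definition weakly_summable V (r : R) (x : nat -> V) :=
  forall f : cont_linear V K^o,
    (lnorm r%:E (fun j => rnorm (f (x j))) < +oo)%E.

Definition weak_norm V (r : R) (x : nat -> V) : \bar R :=
  ereal_sup [set lnorm r%:E (fun j => rnorm (f (x j))) |
    f in [set f : cont_linear V K^o | rnorm f <= 1]].

(* A family x_0, ..., x_(m-1) is encoded by a sequence extended by 0, which does not
   change its (weak) l_p-norm. *)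
Definition truncate {Z : zmodType} (m : nat) (x : nat -> Z) (j : nat) : Z :=
  if (j < m)%N then x j else 0.

Definition summing_bound V W (q : \bar R) (p : R) (u : V -> W) : set R :=
  [set C | 0 <= C /\ forall (m : nat) (x : nat -> V),
    (lnorm q (truncate m (fun j => rnorm (u (x j)))) <=
     C%:E * weak_norm p (truncate m x))%E].

(* Continuity of u follows from the case m = 1. *)
Definition summing V W (q : \bar R) (p : R) : set (V -> W) :=
  [set u | linear u /\ summing_bound q p u !=set0].

Definition summing_norm V W (q : \bar R) (p : R) (u : V -> W) : \bar R :=
  ereal_inf [set C%:E | C in summing_bound q p u].

End normed_space_notions.

Section tensor.
Context {R : realType} {k : base_field} {n : nat}.
Local Notation K := (scalars R k).
Context {E : 'I_n -> normedModType K} {F : normedModType K}.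

Lemma tensor_subproof (A : cont_multilinear E K^o) (y : F) :
  (fun x => A x *: y) \in @cont_multilinear_pred R k n E F.
Proof.
have [mA cA] := cont_multilinearP A.
apply/mem_set; split=> [x i a u v|x].
  by rewrite [A _](mA x i a u v) scalerDl scalerA.
pose P := prod_topology (fun i => E i).
have FF : Filter (nbhs (x : P)) by exact: nbhs_filter.
exact: (@cvgZr_tmp _ _ _ _ FF _ _ _ (cA x)).
Qed.

Definition tensor (A : cont_multilinear E K^o) (y : F) : cont_multilinear E F :=
  ContMultilinear (tensor_subproof A y).

End tensor.

Section hyper_nuclear.
Context {R : realType} {k : base_field} {n : nat}.
Local Notation K := (scalars R k).
Variables (s r : R) (E : 'I_n -> normedModType K) (F : normedModType K).

Definition hn_representation (A : cont_multilinear E F) (lambda : nat -> K^o)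
    (T : nat -> cont_multilinear E K^o) (y : nat -> F) :=
  [/\ (lnorm s%:E (fun j => rnorm (lambda j)) < +oo)%E,
      weakly_summable r T,
      (lnorm +oo (fun j => rnorm (y j)) < +oo)%E &
      forall x : forall i, E i,
        series (fun j => lambda j *: (T j x *: y j)) @ \oo --> A x].

Definition hn_pred : {pred cont_multilinear E F} :=
  mem [set A | exists lambda T y, hn_representation A lambda T y].

Definition hn_norm (A : cont_multilinear E F) : \bar R :=
  ereal_inf [set N | exists lambda T y, hn_representation A lambda T y /\
    N = (lnorm s%:E (fun j => rnorm (lambda j)) * weak_norm r T *
         lnorm +oo (fun j => rnorm (y j)))%E].

Record hyper_nuclear := HyperNuclear {
  hn_val :> cont_multilinear E F;
  _ : hn_val \in hn_pred }.

Lemma hn_tensor_subproof (A : cont_multilinear E K^o) (y : F) :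
  tensor A y \in hn_pred.
Proof.
apply/mem_set; exists (fun j => if j is 0%N then 1 else 0).
exists (fun j => if j is 0%N then A else 0).
exists (fun j => if j is 0%N then y else 0).
have E0 (V : normedModType K) (v : V) :
    (fun j => rnorm (if j is 0%N then v else 0)) =
    (fun j => if j is 0%N then rnorm v else 0).
  by apply/funext => -[|j] /=; rewrite ?rnorm0.
split.
- by rewrite (E0 K^o); exact: lnorm_single_lty.
- move=> f; rewrite (_ : (fun j => _) =
      (fun j => if j is 0%N then rnorm (f A) else 0)); first exact: lnorm_single_lty.
  have [lf _] := cont_linearP f.
  apply/funext => -[|j]//=; have := lf (- 1) 0 0.
  by rewrite scaler0 add0r scaleN1r addNr => ->; rewrite rnorm0.
- by rewrite E0; exact: lnorm_single_lty.
- move=> x; rewrite -(@cvg_shiftS _); apply: cvg_near_cst; apply: nearW => N.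
  rewrite /series/= big_nat_recl//= big1 ?addr0 ?scale1r// => j _.
  by rewrite scale0r.
Qed.

HB.instance Definition _ := [isSub for hn_val].
HB.instance Definition _ := [Choice of hyper_nuclear by <:].

Lemma hn_submod_closed : submod_closed hn_pred.
Proof.
split=> [|c A B /set_mem[l1 [T1 [y1 [l1s T1s y1s A1]]]]
               /set_mem[l2 [T2 [y2 [l2s T2s y2s B2]]]]].
  have -> : (0 : cont_multilinear E F) = tensor 0 0.
    by apply/val_inj/funext => x; rewrite [RHS]scaler0.
  exact: hn_tensor_subproof.
apply/mem_set; exists (interleave (fun j => c *: l1 j) l2).
exists (interleave T1 T2), (interleave y1 y2); split.
- rewrite (map_interleave (@rnorm _ _ K^o)).
  apply: lnorm_interleave => //=.
  rewrite (_ : (fun j => rnorm _) = fun j => `|rnorm (c : K^o)| * rnorm (l1 j)).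
    exact: lnormZ_lty.
  by apply/funext => j /=; rewrite rnormZ ger0_norm ?rnorm_ge0.
- move=> f; rewrite (map_interleave (fun T => rnorm (f T))).
  by apply: lnorm_interleave; [|exact: T1s|exact: T2s].
- by rewrite (map_interleave (@rnorm _ _ F)); exact: lnorm_interleave.
- move=> x; rewrite -[X in _ --> X]/(c *: A x + B x).
  rewrite (_ : (fun j => _) = interleave (fun j => c *: (l1 j *: (T1 j x *: y1 j)))
     (fun j => l2 j *: (T2 j x *: y2 j))); last first.
    by apply/funext => j; rewrite /interleave; case: ifP => // _; rewrite [RHS]scalerA.
  apply: series_interleave; last exact: B2.
  rewrite (_ : series _ = c \*: series (fun j => l1 j *: (T1 j x *: y1 j))).
    exact: cvgZl_tmp (A1 x).
  by apply/funext => N; rewrite /series/= scaler_sumr.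
Qed.

HB.instance Definition _ :=
  GRing.isSubmodClosed.Build _ _ hn_pred hn_submod_closed.
HB.instance Definition _ := [SubChoice_isSubLmodule of hyper_nuclear by <:].

Definition hn_tensor (A : cont_multilinear E K^o) (y : F) : hyper_nuclear :=
  HyperNuclear (hn_tensor_subproof A y).

Definition hn_dual_norm (phi : hyper_nuclear -> K^o) : \bar R :=
  ereal_sup [set (rnorm (phi A))%:E | A in [set A : hyper_nuclear | (hn_norm A <= 1)%E]].

Definition hn_dual_pred : {pred hyper_nuclear -> K^o} :=
  mem [set phi | linear phi /\ (hn_dual_norm phi < +oo)%E].

Record hn_dual := HnDual {
  hn_dual_fun :> hyper_nuclear -> K^o;
  _ : hn_dual_fun \in hn_dual_pred }.

HB.instance Definition _ := [isSub for hn_dual_fun].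
HB.instance Definition _ := [Choice of hn_dual by <:].

Lemma hn_dual_submod_closed : submod_closed hn_dual_pred.
Proof.
split=> [|c f g /set_mem[lf ff] /set_mem[lg fg]]; apply/mem_set.
  split; first by move=> a x y; rewrite [RHS]addr0 [RHS]scaler0.
  apply: (@le_lt_trans _ _ 0%E); last exact: ltry.
  by apply: ge_ereal_sup => _ [A _ <-]; rewrite lee_fin [X in X <= _]rnorm0.
split=> [a x y|].
  rewrite -[LHS]/(c *: f (a *: x + y) + g (a *: x + y)).
  rewrite -[RHS]/(a *: (c *: f x + g x) + (c *: f y + g y)) lf lg.
  rewrite !scalerDr !scalerA (mulrC c a) -!addrA.
  by congr (_ + _); rewrite addrCA.
apply: (@le_lt_trans _ _ ((rnorm (c : K^o))%:E * hn_dual_norm f + hn_dual_norm g)%E).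
  apply: ge_ereal_sup => _ [A A1 <-].
  apply: (@le_trans _ _ ((rnorm (c : K^o))%:E * (rnorm (f A))%:E + (rnorm (g A))%:E)%E).
    by rewrite -EFinM -EFinD lee_fin -(@rnormZ _ _ K^o) ler_rnormD.
  apply: leeD; last by apply: ereal_sup_ubound; exists A.
  rewrite lee_wpmul2l ?lee_fin ?rnorm_ge0//.
  by apply: ereal_sup_ubound; exists A.
by rewrite lte_add_pinfty// lte_mul_pinfty// lee_fin rnorm_ge0.
Qed.

HB.instance Definition _ :=
  GRing.isSubmodClosed.Build _ _ hn_dual_pred hn_dual_submod_closed.
HB.instance Definition _ := [SubChoice_isSubLmodule of hn_dual by <:].

End hyper_nuclear.

Arguments hn_tensor {R k n} s r {E F} A y.

(* Main.v *)
(* Hoelder's inequality shows that a representation A = sum_j l_j T_j (x) y_j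
   gives |sum_j l_j u(T_j)(y_j)| <= ||l||_s pi(u) ||T||_(w,r) ||y||_oo for every
   (s^*, r)-summing u, and its converse on finite sums shows that every functional
   on HN_(s,r) induces a summing operator of at most its norm.  The two bounds match
   because the tails of a representation are small in the hyper-nuclear norm, so a
   functional is determined by its values on the tensors T (x) y.

   It remains to see that sum_j l_j u(T_j)(y_j) depends only on A, i.e. vanishes when
   A = 0.  This is clear with T_j replaced by P T_j for P of finite rank: then
   u(P T_j) = sum_i f_i(T_j) u(w_i), and sum_j l_j u(w_i)(y_j) T_j converges to 0
   in norm (this uses 1 <= 1/s + 1/r), hence is killed by f_i.  The error term has
   ||(T_j - P T_j)_j||_(w,r) <= (1 + ||P||) ||T||_(w,r), so its tail is small
   uniformly in P, and the bounded approximation property makes the finitely many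
   remaining terms small. *)
Require Import Defs.
From HB Require Import structures.
From mathcomp Require Import all_boot all_order all_algebra.
From mathcomp Require Import complex.
From mathcomp Require Import all_classical all_reals all_analysis.
From mathcomp Require Import ess_sup_inf.
From mathcomp Require Import lra ring.

Set Implicit Arguments.
Unset Strict Implicit.
Unset Printing Implicit Defensive.
Import Order.TTheory GRing.Theory Num.Theory.
Import numFieldNormedType.Exports.
Local Open Scope classical_set_scope.
Local Open Scope ring_scope.

(** * Sequence norms *)

Lemma sum_addn (V : zmodType) (u : nat -> V) (N M : nat) :
  \sum_(0 <= j < N + M) u j = \sum_(0 <= j < N) u j + \sum_(0 <= j < M) u (N + j)%N.
Proof.
elim: M => [|M IH]; first by rewrite addn0 [X in _ + X]big_geq// addr0.
by rewrite addnS !big_nat_recr//= IH addrA.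
Qed.

Section lnorm_theory.
Context {R : realType}.
Implicit Types (a b : nat -> R) (p : \bar R).
Local Open Scope ereal_scope.

Lemma lnorm_ge0 p a : 0 <= lnorm p a.
Proof. exact: Lnorm_ge0. Qed.

Lemma lnorm_le_sumP (p : R) a (M : R) : (0 < p)%R -> (0 <= M)%R ->
  lnorm p%:E a <= M%:E <->
  forall N, (\sum_(0 <= j < N) `|a j| `^ p <= M `^ p)%R.
Proof.
move=> p0 M0; rewrite /lnorm Lnorm_counting//=.
pose f j := (`|a j| `^ p)%:E.
have f0 j : 0 <= f j by rewrite lee_fin powR_ge0.
rewrite (eq_eseriesr (g := f))//.
set S := \sum_(_ <oo) _.
have S0 : 0 <= S by exact: nneseries_ge0.
have -> : (S `^ p^-1 <= M%:E) <-> (S <= (M `^ p)%:E).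
  have p10 : (0 <= p^-1)%R by rewrite invr_ge0 ltW.
  split=> h.
    have := @gt0_ler_poweR _ p (ltW p0) (S `^ p^-1) M%:E.
    rewrite -poweRrM mulVf ?gt_eqF// poweRe1// => /(_ _ _ h).
    by apply; rewrite in_itv/= ?poweR_ge0 ?leey ?lee_fin ?M0.
  have := @gt0_ler_poweR _ p^-1 p10 S (M `^ p)%:E.
  rewrite -poweR_EFin -poweRrM mulfV ?gt_eqF// poweRe1//; apply => //.
    by rewrite in_itv/= S0 leey.
  by rewrite in_itv/= lee_fin powR_ge0 leey.
split=> [SM N|SM].
  rewrite -lee_fin; apply: le_trans SM; rewrite -sumEFin.
  exact: nneseries_lim_ge.
apply: lime_le; first exact: is_cvg_nneseries.
by apply: nearW => N; rewrite sumEFin lee_fin.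
Qed.

(** A singleton has counting measure 1, so negligible sets are empty and the essential supremum is a
    true supremum. *)
Lemma lnormy_leP a (M : R) : lnorm +oo a <= M%:E <-> forall j, (`|a j| <= M)%R.
Proof.
have cT : 0 < @counting nat R [set: nat].
  by rewrite /counting asboolF//; exact: infinite_nat.
rewrite /lnorm unlock cT; split=> [aM j|aM]; last first.
  by apply/ess_supP; apply: nearW => j; rewrite /= lee_fin.
have /= [A [mA A0 PA]] := ess_sup_ge (@counting nat R) (abse \o (EFin \o a)).
rewrite -lee_fin; apply: le_trans aM; rewrite leNgt; apply/negP => naj.
have : @counting nat R [set j] <= @counting nat R A.
  apply: le_measure; rewrite ?inE// => _ ->; apply: PA => /=.
  by apply/negP; rewrite -ltNge.
by rewrite A0 /counting asboolT// fset_set1 finmap.cardfs1 lee_fin ler10.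
Qed.

Lemma lnorm_le p a b : 0 < p -> (forall j, `|a j| <= `|b j|)%R ->
  lnorm p a <= lnorm p b.
Proof.
case: p => [p|_|//]; last first.
  move=> ab; case E : (lnorm +oo b) => [M||]; last 2 first.
  - exact: leey.
  - by have := lnorm_ge0 +oo b; rewrite E.
  by apply/lnormy_leP => j; apply: le_trans (ab j) _; move: j; apply/lnormy_leP; rewrite E.
rewrite lte_fin => p0 ab; case E : (lnorm p%:E b) => [M||]; last 2 first.
- exact: leey.
- by have := lnorm_ge0 p%:E b; rewrite E.
have M0 : (0 <= M)%R by rewrite -lee_fin -E lnorm_ge0.
apply/lnorm_le_sumP => // N.
have := (@lnorm_le_sumP p b M p0 M0).1.
rewrite E => /(_ (lexx _) N); apply: le_trans; apply: ler_sum => j _.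
by rewrite ge0_ler_powR// ltW.
Qed.

Lemma lnormZ_le p a (c M : R) : 0 < p -> lnorm p a <= M%:E ->
  lnorm p (fun j => c * a j)%R <= (`|c| * M)%:E.
Proof.
move=> p0 aM; have M0 : (0 <= M)%R by rewrite -lee_fin (le_trans (lnorm_ge0 p a)).
case: p p0 aM => [p|_|//]; last first.
  move=> /lnormy_leP aM; apply/lnormy_leP => j.
  by rewrite normrM ler_wpM2l.
rewrite lte_fin => p0 /lnorm_le_sumP => /(_ p0 M0) aM.
apply/lnorm_le_sumP => //; first by rewrite mulr_ge0.
move=> N; rewrite powRM// (eq_bigr (fun j => `|c| `^ p * `|a j| `^ p)%R).
  by rewrite -mulr_sumr ler_wpM2l ?powR_ge0.
by move=> j _; rewrite normrM powRM.
Qed.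

Lemma lnormD p a b : 1 <= p -> lnorm p (a \+ b)%R <= lnorm p a + lnorm p b.
Proof. by move=> p1; exact: eminkowski. Qed.

Lemma lnorm_truncate p a N : 0 < p -> lnorm p (truncate N a) <= lnorm p a.
Proof.
by move=> p0; apply: lnorm_le => // j; rewrite /truncate; case: ifP; rewrite ?normr0.
Qed.

Lemma lnorm_le_truncate p a (M : R) : 0 < p ->
  (forall N, lnorm p (truncate N a) <= M%:E) -> lnorm p a <= M%:E.
Proof.
move=> p0 aM; have M0 : (0 <= M)%R by rewrite -lee_fin (le_trans (lnorm_ge0 p _) (aM 0%N)).
case: p p0 aM => [p|_|//]; last first.
  move=> aM; apply/lnormy_leP => j; have /lnormy_leP/(_ j) := aM j.+1.
  by rewrite /truncate ltnSn.
rewrite lte_fin => p0 aM; apply/lnorm_le_sumP => // N.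
have /(lnorm_le_sumP _ p0 M0)/(_ N) := aM N.
by congr (_ <= _)%R; apply: eq_big_nat => j /andP[_ jN]; rewrite /truncate jN.
Qed.

Lemma lnorm_shift p a N : 0 < p -> lnorm p (fun j => a (N + j)%N) <= lnorm p a.
Proof.
case: p => [p|_|//]; last first.
  case E : (lnorm +oo a) => [M||]; last 2 first.
  - by rewrite leey.
  - by have := lnorm_ge0 +oo a; rewrite E.
  by apply/lnormy_leP => j; move: (N + j)%N; apply/lnormy_leP; rewrite E.
rewrite lte_fin => p0; case E : (lnorm p%:E a) => [M||]; last 2 first.
- by rewrite leey.
- by have := lnorm_ge0 p%:E a; rewrite E.
have M0 : (0 <= M)%R by rewrite -lee_fin -E lnorm_ge0.
apply/lnorm_le_sumP => // m.
have := (@lnorm_le_sumP p a M p0 M0).1.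
rewrite E => /(_ (lexx _) (N + m)%N); apply: le_trans.
rewrite (@big_cat_nat _ _ _ N 0 (N + m))//= ?leq_addr// -{3}(add0n N) big_addn addKn.
rewrite [leRHS]addrC -[leLHS]addr0 lerD//; last by rewrite sumr_ge0// => *; exact: powR_ge0.
by rewrite le_eqVlt; apply/orP; left; apply/eqP; apply: eq_bigr => j _; rewrite addnC.
Qed.

(** For a finite exponent, this is the convergence to 0 of the tails of a summable series, compared
    with the p-th power of [e]. *)
Lemma lnorm_tail (p : R) a (e : R) : (0 < p)%R -> lnorm p%:E a < +oo ->
  (0 < e)%R -> exists N0, forall N, (N0 <= N)%N ->
    lnorm p%:E (fun j => a (N + j)%N) <= e%:E.
Proof.
move=> p0 afin e0.
have pa0 (j : nat) : xpredT j -> 0 <= (`|a j| `^ p)%:E by rewrite lee_fin powR_ge0.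
have /nneseries_tail_cvg /(_ pa0) : \sum_(0 <= j <oo) (`|a j| `^ p)%:E < +oo.
  by apply/lnorm_lty => //; rewrite gt_eqF.
have ep0 : (0 < e `^ p)%R by rewrite powR_gt0.
move=> /fine_cvgP [[N1 _ N1fin]] /cvgrPdist_lt/(_ _ ep0)[N2 _ N2e].
exists (maxn N1 N2) => N; rewrite geq_max => /andP[/N1fin Nfin /N2e].
rewrite /= sub0r normrN => Ne; apply/lnorm_le_sumP => //; first exact: ltW.
move=> m; apply: le_trans (ltW (le_lt_trans (ler_norm _) Ne)).
rewrite -lee_fin fineK// -sumEFin.
have := @nneseries_lim_ge _ (fun j => (`|a j| `^ p)%:E) xpredT N (N + m)%N.
move=> /(_ (fun j _ => pa0 j)); apply: le_trans.
rewrite -{2}(add0n N) big_addn addKn.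
by apply: lee_sum => j _; rewrite addnC.
Qed.

(** For s = 1 the conjugate exponent is [+oo] and the supremum factors out; for s > 1 this is
    Hölder's inequality for the counting measure. *)
Lemma hoelder_sum (s : R) a b (M L : R) N : (1 <= s)%R ->
  lnorm s%:E a <= M%:E -> lnorm (hoelder_conjugate s%:E) b <= L%:E ->
  (\sum_(0 <= j < N) `|a j| * `|b j| <= M * L)%R.
Proof.
move=> s1 aM bL.
have M0 : (0 <= M)%R by rewrite -lee_fin (le_trans _ aM)// lnorm_ge0.
have L0 : (0 <= L)%R by rewrite -lee_fin (le_trans _ bL)// lnorm_ge0.
move: s1; rewrite le_eqVlt => /predU1P[s1|s1].
  move: aM bL; rewrite -{}s1 hoelder_conjugate1 => aM /lnormy_leP bL.
  apply: (@le_trans _ _ (\sum_(0 <= j < N) `|a j| * L)%R).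
    by apply: ler_sum => j _; rewrite ler_wpM2l.
  rewrite -mulr_suml ler_wpM2r//.
  have /lnorm_le_sumP := aM => /(_ ltr01 M0 N); rewrite powRr1//.
  by under eq_bigr do rewrite powRr1//.
have s0 : (0 < s)%R by rewrite (lt_trans ltr01).
have qE : hoelder_conjugate s%:E = (s / (s - 1))%:E.
  by rewrite /hoelder_conjugate/= gt_eqF// inver subr_eq0 gt_eqF.
have q0 : (0 < s / (s - 1))%R by rewrite divr_gt0 ?subr_gt0.
have sq : (s^-1 + (s / (s - 1))^-1 = 1)%R.
  by field; rewrite subr_eq0 !gt_eqF.
have mT (g : nat -> R) : measurable_fun [set: nat] g by [].
have := @hoelder _ _ R (@counting nat R) a b s (s / (s - 1)) (mT a) (mT b) s0 q0 sq.
rewrite -/(lnorm s%:E a) -qE -/(lnorm _ b) -/(lnorm 1 _) => h.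
have : lnorm 1 (a \* b)%R <= (M * L)%:E.
  by apply: le_trans h _; rewrite EFinM lee_pmul// lnorm_ge0.
move/lnorm_le_sumP => /(_ ltr01 (mulr_ge0 M0 L0) N); rewrite powRr1 ?mulr_ge0//.
by under eq_bigr do rewrite powRr1// normrM.
Qed.

Lemma lnorm_truncate_le (p : R) a (M : R) N : (0 < p)%R -> (0 <= M)%R ->
  (\sum_(0 <= j < N) `|a j| `^ p <= M `^ p)%R ->
  lnorm p%:E (truncate N a) <= M%:E.
Proof.
move=> p0 M0 aM; apply/lnorm_le_sumP => // m; apply: le_trans aM.
have E j : (`|truncate N a j| `^ p = truncate N (fun j => `|a j| `^ p) j)%R.
  by rewrite /truncate; case: ifP => // _; rewrite normr0 powR0// gt_eqF.
rewrite (eq_bigr _ (fun j _ => E j)).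
have [mN|Nm] := leqP m N.
  rewrite (@big_cat_nat _ _ _ m 0 N)//= -[leLHS]addr0 lerD//; last first.
    by rewrite sumr_ge0// => *; exact: powR_ge0.
  by apply: ler_sum_nat => j /andP[_ jm]; rewrite /truncate (leq_trans _ mN).
rewrite (@big_cat_nat _ _ _ N 0 m)//= 1?ltnW// [X in (_ + X)%R]big_nat [X in (_ + X)%R]big1.
  by rewrite addr0; apply/ler_sum_nat => j /andP[_ jN]; rewrite /truncate jN.
by move=> j /andP[Nj _]; rewrite /truncate ltnNge Nj.
Qed.

(** Converse of Hölder's inequality on finite sums: the equality case of the inequality is used as
    test sequence. *)
Lemma hoelder_dual (s : R) N b (D : R) : (1 <= s)%R -> (0 <= D)%R ->
  (forall (l : nat -> R) (M : R), (forall j, 0 <= l j)%R -> (lnorm s%:E l <= M%:E)%E ->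
     \sum_(0 <= j < N) l j * `|b j| <= M * D)%R ->
  lnorm (hoelder_conjugate s%:E) (truncate N b) <= D%:E.
Proof.
move=> s1 D0 h; move: s1; rewrite le_eqVlt => /predU1P[s1|s1].
  rewrite -s1 hoelder_conjugate1; apply/lnormy_leP => j; rewrite /truncate.
  case: ifPn => jN; last by rewrite normr0.
  (* For s = 1 the test sequences are the unit vectors. *)
  have := h (fun i => (i == j)%:R)%R 1%R (fun=> ler0n _ _).
  rewrite -s1 mul1r (big_nat_widenl _ 0)//= => h1.
  apply: le_trans (h1 _); last first.
    apply/lnorm_le_sumP => // m; rewrite powR1.
    have [jm|mj] := ltnP j m.
      rewrite (bigD1_seq j) ?mem_index_iota ?iota_uniq//= eqxx normr1 powR1.
      rewrite big1 ?addr0// => i /negbTE ->.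
      by rewrite normr0 powR0.
    rewrite big_nat big1// => i /andP[_ im].
    by rewrite ltn_eqF ?(leq_trans im)// normr0 powR0.
  rewrite (bigD1_seq j) ?mem_index_iota ?iota_uniq//= eqxx mul1r lerDl.
  by rewrite sumr_ge0// => i _; rewrite mulr_ge0.
have s0 : (0 < s)%R by rewrite (lt_trans ltr01).
rewrite /hoelder_conjugate/= gt_eqF// inver subr_eq0 gt_eqF//.
set q := (s / (s - 1))%R.
have q0 : (0 < q)%R by rewrite divr_gt0 ?subr_gt0.
have sqq : ((q - 1) * s = q)%R by rewrite /q; field; rewrite subr_eq0 gt_eqF.
have q1 : (0 < q - 1)%R by rewrite -(pmulr_lgt0 _ s0) sqq.
pose S := (\sum_(0 <= j < N) `|b j| `^ q)%R.
have S0 : (0 <= S)%R by rewrite sumr_ge0// => *; exact: powR_ge0.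
have SD : (S <= D `^ q)%R.
  move: S0; rewrite le_eqVlt => /predU1P[<-|S0]; first exact: powR_ge0.
  (* The test sequence has entries |b_j|^(q-1). As (q-1)s = q, its l_s-norm is S^(1/s), while its
     pairing with b is S; dividing by S^(1/s) then leaves S^(1/q) <= D. *)
  have {}SD : (S <= S `^ s^-1 * D)%R.
    rewrite {1}(_ : S = \sum_(0 <= j < N) truncate N (fun j => `|b j| `^ (q - 1)) j * `|b j|)%R.
      apply: h.
        by move=> j; rewrite /truncate; case: ifP => // _; exact: powR_ge0.
      apply: lnorm_truncate_le; rewrite ?powR_ge0//.
      rewrite -powRrM mulVf ?gt_eqF// powRr1; last exact: ltW.
      by apply: ler_sum => j _; rewrite ger0_norm ?powR_ge0// -powRrM sqq.
    apply: eq_big_nat => j /andP[_ jN]; rewrite /truncate jN mulrC.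
    by rewrite mulr_powRB1.
  have {}SD : (S `^ q^-1 <= D)%R.
    rewrite -(ler_pM2l (powR_gt0 s^-1 S0)); apply: le_trans SD.
    rewrite -powRD; last by rewrite (gt_eqF S0) implybT.
    have -> : (s^-1 + q^-1 = 1)%R by rewrite /q; field; rewrite subr_eq0 !gt_eqF.
    by rewrite powRr1// ltW.
  have := ge0_ler_powR (ltW q0) _ _ SD.
  by rewrite -powRrM mulVf ?gt_eqF// powRr1 ?(ltW S0)//; apply; rewrite nnegrE ?powR_ge0.
exact: lnorm_truncate_le.
Qed.

(** The condition 1 <= 1/s + 1/r says that r is at most the conjugate exponent q of s. Each |b_j| is
    at most M, so |b_j|^q <= M^(q-r) |b_j|^r, which sums to at most M^q. *)
Lemma lnorm_conjugate_le (s r : R) b (M : R) : (1 <= s)%R -> (1 <= r)%R ->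
  (1 <= s^-1 + r^-1)%R -> lnorm r%:E b <= M%:E ->
  lnorm (hoelder_conjugate s%:E) b <= M%:E.
Proof.
move=> s1 r1 sr bM.
have M0 : (0 <= M)%R by rewrite -lee_fin (le_trans _ bM)// lnorm_ge0.
have r0 : (0 < r)%R by rewrite (lt_le_trans ltr01).
move/(lnorm_le_sumP _ r0 M0) : bM => bM.
have bjM j : (`|b j| <= M)%R.
  have : (`|b j| `^ r <= M `^ r)%R.
    apply: le_trans (bM j.+1); rewrite big_nat_recr//= lerDr.
    by rewrite sumr_ge0// => *; exact: powR_ge0.
  move/(ge0_ler_powR (_ : 0 <= r^-1)%R).
  rewrite invr_ge0 (ltW r0) -!powRrM mulfV ?gt_eqF// !powRr1//.
  by apply; rewrite ?nnegrE ?powR_ge0.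
move: s1; rewrite le_eqVlt => /predU1P[s1|s1].
  by rewrite -s1 hoelder_conjugate1; apply/lnormy_leP.
have s0 : (0 < s)%R by rewrite (lt_trans ltr01).
rewrite /hoelder_conjugate/= gt_eqF// inver subr_eq0 gt_eqF//.
set q := (s / (s - 1))%R.
have q0 : (0 < q)%R by rewrite divr_gt0 ?subr_gt0.
have rq : (r <= q)%R.
  rewrite -[r]invrK -[q]invrK lef_pV2 ?posrE ?invr_gt0//.
  have -> : (q^-1 = 1 - s^-1)%R by rewrite /q; field; rewrite subr_eq0 !gt_eqF.
  lra.
apply/lnorm_le_sumP => // N.
have [M00|M1] := eqVneq M 0%R.
  rewrite big1 ?powR_ge0// => j _.
  have : (`|b j| <= 0)%R by rewrite -M00.
  by rewrite normr_le0 => /eqP ->; rewrite normr0 powR0// gt_eqF.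
have {M1}M1 : (0 < M)%R by rewrite lt_neqAle eq_sym M1.
rewrite -/q -(subrK r q).
rewrite powRD ?(gt_eqF M1) ?implybT//.
apply: (@le_trans _ _ (M `^ (q - r) * \sum_(0 <= j < N) `|b j| `^ r)%R); last first.
  by rewrite ler_wpM2l// powR_ge0.
rewrite mulr_sumr; apply: ler_sum => j _.
have [->|b0] := eqVneq (b j) 0%R.
  by rewrite normr0 !powR0 ?mulr0// ?gt_eqF// subrK.
rewrite powRD; last by rewrite normr_eq0 (negbTE b0) implybT.
by rewrite ler_wpM2r ?powR_ge0// ge0_ler_powR ?subr_ge0.
Qed.

End lnorm_theory.

(** * Scalars *)

Section scalar_sequences.
Context {R : realType} {k : base_field}.
Local Notation K := (scalars R k).

Lemma rnorm_cvgP (V : normedModType K) (z : nat -> V) (l : V) :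
  z @ \oo --> l <-> (forall e : R, 0 < e -> exists N0, forall N, (N0 <= N)%N ->
    rnorm (l - z N) <= e).
Proof.
split=> [/cvgrPdist_le zl e e0|zl].
  have e0' : 0 < of_real e :> K.
    by rewrite lt_def -of_real0 ler_of_real ltW// (inj_eq (can_inj of_realK)) gt_eqF.
  have [N0 _ zN] := zl _ e0'.
  by exists N0 => N /zN; rewrite -of_real_rnorm ler_of_real.
apply/cvgrPdist_le => e e0.
have e0' : 0 < to_real e.
  rewrite lt_def -(@ler_of_real R k) of_real0 ge0_to_realK ?ltW// andbT.
  by apply/eqP => h; move: (e0); rewrite -(ge0_to_realK (ltW e0)) h of_real0 ltxx.
have [N0 zN] := zl _ e0'; exists N0 => // N /zN.
by rewrite -of_real_rnorm -(@ler_of_real R k) ge0_to_realK// ltW.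
Qed.

Lemma rnormN (V : normedModType K) (v : V) : rnorm (- v) = rnorm v.
Proof. by rewrite /rnorm normrN. Qed.

Lemma rnormB (V : normedModType K) (v w : V) : rnorm (v - w) = rnorm (w - v).
Proof. by rewrite -rnormN opprB. Qed.

Lemma rnorm1 : rnorm (1 : K^o) = 1.
Proof. by rewrite /rnorm normr1 -(@of_realK R k 1) of_real1. Qed.

Lemma rnorm_of_real (a : R) : rnorm (of_real a : K^o) = `|a|.
Proof.
rewrite /rnorm -[RHS](@of_realK R k); congr to_real.
by rewrite /of_real; case: k => //=; rewrite normc_def/= expr0n/= addr0 sqrtr_sqr.
Qed.

Lemma ler_rnorm_sum (V : normedModType K) (u : nat -> V) N :
  rnorm (\sum_(0 <= j < N) u j) <= \sum_(0 <= j < N) rnorm (u j).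
Proof.
elim/big_ind2 : _ => [|x a y b xa yb|//]; first by rewrite rnorm0.
by rewrite (le_trans (ler_rnormD _ _))// lerD.
Qed.

End scalar_sequences.

(** Completeness of the scalars, the complex case being split into real and imaginary parts. [t] is
    a Cauchy modulus: one index with [t n <= e] controls all later terms. *)
Lemma scalar_cauchy (R : realType) (k : base_field) (z : nat -> (scalars R k)^o)
    (t : nat -> R) :
  (forall n m, (n <= m)%N -> rnorm (z m - z n) <= t n) ->
  (forall e, 0 < e -> exists n, t n <= e) ->
  exists l : (scalars R k)^o, z @ \oo --> l.
Proof.
have real_case (u : nat -> R) : (forall n m, (n <= m)%N -> `|u m - u n| <= t n) ->
    (forall e, 0 < e -> exists n, t n <= e) -> exists l : R, u @ \oo --> l.
  move=> ut t0; apply/cvg_ex; apply: R_complete; apply/cauchyP => e e0.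
  have [n tn] := t0 _ (divr_gt0 e0 (@ltr0n R 2)).
  exists (u n), n => // m /= nm; rewrite /ball/= distrC (le_lt_trans (ut _ _ nm))//.
  by rewrite (le_lt_trans tn)// ltr_pdivrMr// ltr_pMr// ltr1n.
case: k z => z zt t0; first exact: real_case zt t0.
have normcE (a b : R) : @rnorm R ComplexScalars R[i]^o (Complex a b) = Num.sqrt (a ^+ 2 + b ^+ 2).
  by [].
have [a za] : exists a : R, (fun n => complex.Re (z n)) @ \oo --> a.
  apply: real_case => // n m nm; apply: le_trans (zt n m nm).
  rewrite -raddfB; case: (z m - z n) => x y /=.
  by rewrite -sqrtr_sqr ler_wsqrtr// lerDl sqr_ge0.
have [b zb] : exists b : R, (fun n => complex.Im (z n)) @ \oo --> b.
  apply: real_case => // n m nm; apply: le_trans (zt n m nm).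
  rewrite -raddfB; case: (z m - z n) => x y /=.
  by rewrite -sqrtr_sqr ler_wsqrtr// lerDr sqr_ge0.
exists (Complex a b : R[i]^o).
apply/(@rnorm_cvgP R ComplexScalars R[i]^o) => e e0.
have e20 : 0 < e / 2 by rewrite divr_gt0.
have /cvgrPdist_le/(_ _ e20)[N1 _ N1a] := za.
have /cvgrPdist_le/(_ _ e20)[N2 _ N2b] := zb.
exists (maxn N1 N2) => N; rewrite geq_max => /andP[/N1a /= aN /N2b /= bN].
move: aN bN; case: (z N) => x y /= aN bN.
change (@rnorm R ComplexScalars R[i]^o (Complex (a - x) (b - y)) <= e).
rewrite normcE.
apply: (@le_trans _ _ (`|a - x| + `|b - y|)); last by rewrite [e]splitr lerD.
rewrite -[leRHS](ger0_norm (addr_ge0 (normr_ge0 _) (normr_ge0 _))) -sqrtr_sqr ler_wsqrtr//.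
rewrite -(real_normK (num_real (a - x))) -(real_normK (num_real (b - y))).
by rewrite sqrrD addrAC lerDl mulrn_wge0// mulr_ge0.
Qed.

(** * Continuous linear maps and uniform boundedness *)

Section cont_linear_theory.
Context {R : realType} {k : base_field}.
Local Notation K := (scalars R k).
Implicit Types (V W : normedModType K).

Lemma cont_linear0 V W (f : cont_linear V W) : f 0 = 0.
Proof.
have [lf _] := cont_linearP f; have := lf (- 1) 0 0.
by rewrite scaler0 add0r scaleN1r addNr.
Qed.

Lemma cont_linearD V W (f : cont_linear V W) u v : f (u + v) = f u + f v.
Proof.
by have [lf _] := cont_linearP f; have := lf 1 u v; rewrite !scale1r.
Qed.

Lemma cont_linearZ V W (f : cont_linear V W) c v : f (c *: v) = c *: f v.
Proof.
have [lf _] := cont_linearP f; have := lf c v 0.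
by rewrite !addr0 cont_linear0 addr0.
Qed.

Lemma cont_linearB V W (f : cont_linear V W) u v : f (u - v) = f u - f v.
Proof. by rewrite -scaleN1r cont_linearD cont_linearZ scaleN1r. Qed.

Lemma cont_linear_sum V W (f : cont_linear V W) (N : nat) (u : nat -> V) :
  f (\sum_(0 <= j < N) u j) = \sum_(0 <= j < N) f (u j).
Proof.
elim: N => [|N IH]; first by rewrite !big_geq// cont_linear0.
by rewrite !big_nat_recr//= cont_linearD IH.
Qed.

Lemma rnorm_op_norm V W (f : cont_linear V W) : rnorm f = op_norm f.
Proof. exact: of_realK. Qed.

Lemma rnorm_cont_linear_le V W (f : cont_linear V W) v :
  rnorm (f v) <= rnorm f * rnorm v.
Proof.
have [->|v0] := eqVneq v 0; first by rewrite cont_linear0 !rnorm0 mulr0.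
have rv0 : rnorm v != 0 by apply: contra_neq v0; exact: rnorm0_eq0.
have {}rv0 : 0 < rnorm v by rewrite lt_def rv0 rnorm_ge0.
have := sup_norm_ub (cont_linear_bounded f) (_ : @unit_ball R k V (of_real (rnorm v)^-1 *: v)).
have ri0 : 0 <= (rnorm v)^-1 by rewrite invr_ge0 rnorm_ge0.
rewrite cont_linearZ rnormZ rnorm_of_real (ger0_norm ri0).
rewrite (mulrC _ (rnorm (f v))) (ler_pdivrMr _ _ rv0) rnorm_op_norm; apply.
rewrite /unit_ball/= -of_real_rnorm -(@of_real1 R k) ler_of_real.
by rewrite rnormZ rnorm_of_real (ger0_norm ri0) mulVf ?gt_eqF.
Qed.

Lemma rnorm_cont_linear_ge V W (f : cont_linear V W) (M : R) :
  0 <= M -> (forall v, rnorm (f v) <= M * rnorm v) -> rnorm f <= M.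
Proof.
move=> M0 fM; rewrite rnorm_op_norm; apply: (sup_norm_le (@unit_ball0 R k V)) => v.
rewrite /unit_ball/= -of_real_rnorm -(@of_real1 R k) ler_of_real => v1.
by apply: le_trans (fM v) _; rewrite ler_piMr.
Qed.

Lemma cont_linear_subproof V W (f : V -> W) (M : R) : linear f ->
  (forall v, rnorm (f v) <= M * rnorm v) -> f \in @cont_linear_pred R k V W.
Proof.
move=> lf fM; apply/mem_set; split=> //.
pose l : {linear V -> W} := HB.pack f (GRing.isLinear.Build _ _ _ _ _ lf).
rewrite -[f]/(l : V -> W); apply/linear_bounded_continuous/linear_boundedP.
exists (of_real `|M|); split=> [|x Mx v].
  by rewrite realE -of_real0 ler_of_real normr_ge0.
rewrite -of_real_rnorm; apply: (@le_trans _ _ (of_real (`|M| * rnorm v))).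
  rewrite ler_of_real (le_trans (fM v))// ler_wpM2r ?rnorm_ge0//.
  exact: ler_norm.
by rewrite of_realM of_real_rnorm ler_wpM2r// ltW.
Qed.

Lemma cont_linear_exists V W (f : V -> W) (M : R) : linear f ->
  (forall v, rnorm (f v) <= M * rnorm v) ->
  exists g : cont_linear V W, forall v, g v = f v.
Proof. by move=> lf fM; exists (ContLinear (cont_linear_subproof lf fM)). Qed.

(** The geometric rate turns pointwise limits into a norm limit; the error is the tail of the
    geometric series, since the sum of 3^-i over i >= n is 3/2 times 3^-n. *)
Lemma dual_limit V (g : nat -> cont_linear V K^o) :
  (forall n, rnorm (g n.+1 - g n) <= 3^-1 ^+ n) ->
  exists G : cont_linear V K^o,
    forall n, rnorm (G - g n) <= 3 / 2 * 3^-1 ^+ n.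
Proof.
move=> gS; set t := fun n : nat => 3 / 2 * 3^-1 ^+ n : R.
have t0 n : 0 <= t n by rewrite /t mulr_ge0// exprn_ge0.
(* The bound [t n - t m] telescopes, because [t n - t n.+1] is exactly 3^-n. *)
have gnm n m : (n <= m)%N -> rnorm (g m - g n) <= t n - t m.
  move=> nm; rewrite -(subnKC nm); elim: (m - n)%N => [|i IH].
    by rewrite addn0 !subrr rnorm0.
  rewrite addnS -[g _](subrK (g (n + i)%N)) -addrA.
  apply: le_trans (ler_rnormD _ _) _; apply: le_trans (lerD (gS _) IH) _.
  by rewrite /t exprS; lra.
have gt n m : (n <= m)%N -> rnorm (g m - g n) <= t n.
  by move=> /gnm/le_trans; apply; rewrite gerBl.
have tlim (c e : R) : 0 <= c -> 0 < e -> exists n, t n * c <= e.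
  move=> c0 e0.
  have tc : (fun n => 3 / 2 * c * 3^-1 ^+ n) @ \oo --> (0 : R).
    rewrite -[X in _ --> X](mulr0 (3 / 2 * c)); apply: cvgMr; apply: cvg_expr.
    by rewrite ger0_norm; lra.
  have /cvgrPdist_le/(_ _ e0)[N _ /(_ N (leqnn N))] := tc.
  rewrite /= sub0r normrN => h; exists N; rewrite /t mulrAC.
  exact: le_trans (ler_norm _) h.
have gtv n m v : (n <= m)%N -> rnorm (g m v - g n v) <= t n * rnorm v.
  move=> nm; apply: le_trans (rnorm_cont_linear_le (g m - g n) v) _.
  by rewrite ler_wpM2r ?rnorm_ge0// gt.
have Gex v : exists l : K^o, (fun n => g n v) @ \oo --> l.
  apply: scalar_cauchy (fun n => t n * rnorm v) _ _ => [n m nm|e e0].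
    exact: gtv.
  exact/tlim/e0/rnorm_ge0.
pose G0 v := sval (cid (Gex v)).
have G0P v : (fun n => g n v) @ \oo --> G0 v by rewrite /G0; case: cid.
have G0n n v : rnorm (G0 v - g n v) <= t n * rnorm v.
  apply/ler_addgt0Pr => e e0.
  have [N1 N1P] := (rnorm_cvgP _ _).1 (G0P v) _ e0.
  set m := maxn N1 n.
  rewrite -[G0 v](subrK (g m v)) -addrA (le_trans (ler_rnormD _ _))// [leRHS]addrC.
  by apply: lerD; [apply: N1P|apply: gtv]; rewrite ?leq_maxl ?leq_maxr.
have lG : linear G0.
  move=> a u v; apply: (cvg_unique (@norm_hausdorff K K^o) (G0P _)).
  rewrite (_ : (fun n => _) = (fun n => a *: g n u + g n v)).
    by apply: cvgD; [apply: cvgZl_tmp|].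
  by apply/funext => n; rewrite cont_linearD cont_linearZ.
have [v|G GE] := @cont_linear_exists V K^o G0 (rnorm (g 0%N) + t 0%N) lG.
  rewrite -[G0 v](subrK (g 0%N v)) addrC (le_trans (ler_rnormD _ _))//.
  by rewrite mulrDl lerD// rnorm_cont_linear_le.
exists G => n; apply: rnorm_cont_linear_ge; first exact: t0.
by move=> v; rewrite -[(G - g n) v]/(G v - g n v) GE.
Qed.

(* Sokal's gliding hump: the sign in [g + 3^-n f_n] or [g - 3^-n f_n] is chosen so
   that the n-th seminorm of the result is at least that of [3^-n f_n]; the limit
   then violates pointwise boundedness, and Baire's theorem is not needed. *)
Lemma seminorms_uniformly_bounded V (P : nat -> cont_linear V K^o -> R) :
  (forall N f g, P N (f + g) <= P N f + P N g) ->
  (forall N (c : K) f, P N (c *: f) = rnorm (c : K^o) * P N f) ->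
  (forall N, exists c, forall f, P N f <= c * rnorm f) ->
  (forall f, exists M, forall N, P N f <= M) ->
  exists M, forall N f, rnorm f <= 1 -> P N f <= M.
Proof.
move=> PD PZ Pc Pb; apply: contrapT => unb.
have P0 N : P N 0 = 0 by rewrite -(scale0r 0) PZ (@rnorm0 R k K^o) mul0r.
have PN N f : P N (- f) = P N f by rewrite -scaleN1r PZ (@rnormN R k K^o) rnorm1 mul1r.
have Pge0 N f : 0 <= P N f.
  by have := PD N f (- f); rewrite subrr P0 PN; lra.
pose C N := sup [set P N f | f in [set f | rnorm f <= 1]].
have Cub N f : rnorm f <= 1 -> P N f <= C N.
  move=> f1; apply: ub_le_sup; last by exists f.
  have [c Pcf] := Pc N; exists `|c| => _ [h /= h1 <-].
  apply: le_trans (Pcf h) _; apply: le_trans (ler_norm _) _.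
  by rewrite normrM ler_piMr// ger0_norm// rnorm_ge0.
have PC N f : P N f <= C N * rnorm f.
  have [->|f0] := eqVneq f 0; first by rewrite P0 rnorm0 mulr0.
  have rf0 : 0 < rnorm f.
    by rewrite lt_def rnorm_ge0 andbT; apply: contra_neq f0; exact: rnorm0_eq0.
  have := Cub N (of_real (rnorm f)^-1 *: f); rewrite PZ rnormZ rnorm_of_real.
  rewrite [`|_|]ger0_norm ?invr_ge0 ?rnorm_ge0// mulVf ?gt_eqF// => /(_ (lexx _)).
  by rewrite (mulrC _ (P N f)) ler_pdivrMr.
(* [C N] is the operator norm of the seminorm [P N]. The factor 6 3^n n is what the closing estimate
   requires, where a sixth of 3^-n [C N] has to exceed n. *)
have step n : exists Nf : nat * cont_linear V K^o, [/\ rnorm Nf.2 <= 1,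
    6 * 3 ^+ n * n%:R <= C Nf.1 & 2 / 3 * C Nf.1 <= P Nf.1 Nf.2].
  have : exists N f, rnorm f <= 1 /\ 6 * 3 ^+ n * n%:R < P N f.
    apply: contrapT => h; apply: unb; exists (6 * 3 ^+ n * n%:R) => N f f1.
    by rewrite leNgt; apply/negP => lt; apply: h; exists N, f.
  move=> [N [f [f1 fP]]].
  have CN : 0 < C N.
    apply: lt_le_trans (Cub N f f1); apply: le_lt_trans fP.
    by rewrite !mulr_ge0// exprn_ge0.
  have [h h1 hC] : exists2 h, rnorm h <= 1 & 2 / 3 * C N < P N h.
    have [|_ [h /= h1 <-] hC] := @sup_adherent _ [set P N f | f in [set f | rnorm f <= 1]]
        (C N / 3) (divr_gt0 CN (ltr0n _ 3)).
      split; first by exists (P N f), f.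
      by exists (C N) => _ [h /= h1 <-]; exact: Cub.
    by exists h => //; move: hC; rewrite -/(C N); lra.
  exists (N, h); split=> //=; last exact: ltW.
  by rewrite (le_trans (ltW fP))// Cub.
have [Nf NfP] := choice step.
pose c n : K := of_real (3^-1 ^+ n).
have rc n : rnorm (c n : K^o) = 3^-1 ^+ n by rewrite rnorm_of_real ger0_norm// exprn_ge0.
pose next n (g : cont_linear V K^o) :=
  let h := c n *: (Nf n).2 in
  if P (Nf n).1 h <= P (Nf n).1 (g + h) then g + h else g - h.
(* With h the n-th increment, 2h = (g + h) - (g - h), so the seminorm at g + h or at g - h is at
   least its value at h. *)
have nextP n g : P (Nf n).1 (c n *: (Nf n).2) <= P (Nf n).1 (next n g).
  rewrite /next; case: ifPn => //; rewrite -ltNge; set h := c n *: _ => gh.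
  have := PD (Nf n).1 (g + h) (- (g - h)); rewrite PN opprB.
  have -> : g + h + (h - g) = of_real 2 *: h.
    by rewrite of_realD of_real1 scalerDl scale1r addrC addrA addrNK.
  by rewrite PZ rnorm_of_real ger0_norm//; lra.
pose g := fix g n := if n is n'.+1 then next n' (g n') else 0.
have [n|G GP] := @dual_limit V g.
  rewrite -[g n.+1]/(next n (g n)) /next; case: ifP => _.
    by rewrite addrC addKr rnormZ rc ler_piMr ?exprn_ge0//; case: (NfP n).
  by rewrite addrC addKr rnormN rnormZ rc ler_piMr ?exprn_ge0//; case: (NfP n).
have [M MP] := Pb G.
(* With P and C taken at the n-th chosen index, P(G) >= P(g_(n+1)) - P(g_(n+1) - G) >= (2/3 - 1/2)
   3^-n C >= n, because G is within 3^-n / 2 of g_(n+1). *)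
have nM n : n%:R <= M.
  have [f1 Cn fC] := NfP n.
  have := PD (Nf n).1 G (g n.+1 - G); rewrite addrCA subrr addr0 => h.
  have := nextP n (g n); rewrite PZ rc => h1.
  have e0 : 0 < 3^-1 ^+ n :> R by rewrite exprn_gt0.
  have h2 : 3^-1 ^+ n * (2 / 3 * C (Nf n).1) <= P (Nf n).1 (next n (g n)).
    by rewrite (le_trans _ h1)// ler_pM2l.
  have C0 : 0 <= C (Nf n).1 by rewrite (le_trans _ Cn)// !mulr_ge0// exprn_ge0.
  have h3 : P (Nf n).1 (g n.+1 - G) <= C (Nf n).1 * (2^-1 * 3^-1 ^+ n).
    rewrite (le_trans (PC _ _))// ler_wpM2l// rnormB (le_trans (GP _))//.
    by rewrite exprS; lra.
  have h4 := MP (Nf n).1.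
  have h5 : 3^-1 ^+ n * (6 * 3 ^+ n * n%:R) <= 3^-1 ^+ n * C (Nf n).1.
    by rewrite ler_pM2l.
  have h6 : 3^-1 ^+ n * (6 * 3 ^+ n * n%:R) = 6 * n%:R :> R.
    by rewrite exprVn; field; rewrite expf_neq0.
  move: h h2 h3; rewrite -[g n.+1]/(next n (g n)); nra.
have := nM (Num.bound `|M|); rewrite leNgt => /negP; apply.
by rewrite (le_lt_trans (ler_norm _))// archi_boundP.
Qed.

End cont_linear_theory.

(** * Weak norms and summing maps *)

Section weak_norm_theory.
Context {R : realType} {k : base_field}.
Local Notation K := (scalars R k).
Implicit Types (V W : normedModType K).

Lemma rnormV (c : K) : c != 0 -> rnorm (c^-1 : K^o) = (rnorm (c : K^o))^-1.
Proof.
move=> c0; have h : rnorm (c : K^o) * rnorm (c^-1 : K^o) = 1.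
  by rewrite -(rnormZ c (c^-1 : K^o)) [_ *: _]mulfV// rnorm1.
have rc0 : rnorm (c : K^o) != 0.
  by apply: contra_eq_neq h => ->; rewrite mul0r eq_sym oner_eq0.
by rewrite -[LHS](mulKf rc0) h mulr1.
Qed.

Lemma weak_norm_ge0 V (r : R) (x : nat -> V) : (0 <= weak_norm r x)%E.
Proof.
apply: le_trans (lnorm_ge0 r%:E (fun j => rnorm ((0 : cont_linear V K^o) (x j)))) _.
by apply: ereal_sup_ubound; exists 0 => //=; rewrite rnorm0.
Qed.

(** Homogeneous form of the supremum over the dual unit ball: a nonzero [f] is divided by its
    norm. *)
Lemma weak_norm_leP V (r : R) (x : nat -> V) (w : R) : 0 < r -> 0 <= w ->
  (weak_norm r x <= w%:E)%E <-> forall f : cont_linear V K^o,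
    (lnorm r%:E (fun j => rnorm (f (x j))) <= (rnorm f * w)%:E)%E.
Proof.
move=> r0 w0; split=> [xw f|xw]; last first.
  apply: ge_ereal_sup => _ [f /= f1 <-]; apply: le_trans (xw f) _.
  by rewrite lee_fin ler_piMl.
have [->|f0] := eqVneq f 0.
  apply: (@le_trans _ _ (`|0| * w)%:E); last by rewrite normr0 rnorm0.
  rewrite (_ : (fun j => _) = fun j => 0 * rnorm ((0 : cont_linear V K^o) (x j))).
    apply: lnormZ_le => //; apply: le_trans xw.
    by apply: ereal_sup_ubound; exists 0 => //=; rewrite rnorm0.
  by apply/funext => j; rewrite mul0r -[LHS]/(rnorm (0 : K^o)) rnorm0.
have rf0 : 0 < rnorm f.
  by rewrite lt_def rnorm_ge0 andbT; apply: contra_neq f0; exact: rnorm0_eq0.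
pose g := of_real (rnorm f)^-1 *: f.
have gf v : rnorm (f v) = rnorm f * rnorm (g v).
  rewrite -[g v]/(of_real (rnorm f)^-1 *: f v) rnormZ rnorm_of_real.
  by rewrite ger0_norm ?invr_ge0 ?rnorm_ge0// mulVKf ?gt_eqF.
rewrite (_ : (fun j => _) = fun j => rnorm f * rnorm (g (x j))); last first.
  by apply/funext => j.
rewrite -[rnorm f in leRHS]ger0_norm ?rnorm_ge0//; apply: lnormZ_le => //.
apply: le_trans xw; apply: ereal_sup_ubound; exists g => //=.
by rewrite rnormZ rnorm_of_real ger0_norm ?invr_ge0 ?rnorm_ge0// mulVf ?gt_eqF.
Qed.

(** Uniform boundedness for the seminorms [P N f], the l_r-norm of the first N values of [f] along
    [x]: weak summability bounds them for each [f], hence uniformly on the dual unit ball, and N can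
    then go to infinity. *)
Lemma weakly_summable_fin V (r : R) (x : nat -> V) : 1 <= r ->
  weakly_summable r x -> exists2 w : R, 0 <= w & weak_norm r x = w%:E.
Proof.
move=> r1 xs; have r0 : 0 < r by rewrite (lt_le_trans ltr01).
have r0' : (0 < r%:E)%E by rewrite lte_fin.
pose b (f : cont_linear V K^o) j := rnorm (f (x j)).
have bfin f N : lnorm r%:E (truncate N (b f)) \is a fin_num.
  by rewrite ge0_fin_numE ?lnorm_ge0// (le_lt_trans _ (xs f))// lnorm_truncate.
pose P N f := fine (lnorm r%:E (truncate N (b f))).
have PE N f : (P N f)%:E = lnorm r%:E (truncate N (b f)) by rewrite fineK.
have absb f N j : `|truncate N (b f) j| = truncate N (b f) j.
  by rewrite /truncate; case: ifP => _; rewrite ?normr0// ger0_norm// rnorm_ge0.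
have PZ_le N c f : P N (c *: f) <= rnorm (c : K^o) * P N f.
  rewrite -lee_fin PE -[rnorm (c : K^o)]ger0_norm ?rnorm_ge0//.
  rewrite (_ : truncate _ _ = fun j => rnorm (c : K^o) * truncate N (b f) j).
    by apply: lnormZ_le => //; rewrite PE.
  apply/funext => j; rewrite /truncate; case: ifP => _; last by rewrite mulr0.
  by rewrite -rnormZ.
have [||||M MP] := @seminorms_uniformly_bounded R k V P.
- move=> N f g; rewrite -lee_fin EFinD !PE; apply: le_trans; last exact: lnormD.
  apply: lnorm_le => // j; rewrite absb /= [leRHS]ger0_norm.
    rewrite /truncate; case: ifP => _; last by rewrite addr0.
    exact: ler_rnormD.
  by rewrite addr_ge0// -absb.
- move=> N c f; apply/eqP; rewrite eq_le PZ_le/=.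
  have [->|c0] := eqVneq c 0.
    by rewrite (@rnorm0 R k K^o) mul0r -lee_fin PE lnorm_ge0.
  have := PZ_le N c^-1 (c *: f); rewrite scalerA mulVf// scale1r rnormV//.
  rewrite ler_pdivlMl// lt_def rnorm_ge0 andbT; apply: contra_neq c0.
  exact: (@rnorm0_eq0 _ _ K^o).
- move=> N; pose S := \sum_(0 <= j < N) `|rnorm (x j)| `^ r.
  have S0 : 0 <= S by rewrite sumr_ge0// => *; exact: powR_ge0.
  exists (S `^ r^-1) => f; rewrite -lee_fin PE mulrC -[rnorm f]ger0_norm ?rnorm_ge0//.
  apply: (@le_trans _ _ (lnorm r%:E (fun j => rnorm f * truncate N (fun j => rnorm (x j)) j))).
    apply: lnorm_le => // j; rewrite absb; apply: le_trans (ler_norm _).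
    by rewrite /truncate; case: ifP => _; rewrite ?mulr0// rnorm_cont_linear_le.
  apply: lnormZ_le => //; apply: lnorm_truncate_le => //; first exact: powR_ge0.
  by rewrite -powRrM mulVf ?gt_eqF// powRr1.
- move=> f; exists (fine (lnorm r%:E (b f))) => N.
  rewrite -lee_fin PE fineK ?lnorm_truncate//.
  by rewrite ge0_fin_numE ?lnorm_ge0//; exact: xs.
have : (weak_norm r x <= M%:E)%E.
  apply: ge_ereal_sup => _ [f /= f1 <-]; apply: lnorm_le_truncate => // N.
  by rewrite -PE lee_fin MP.
case: (weak_norm r x) (weak_norm_ge0 r x) => // w w0 _.
by exists w.
Qed.

Lemma weak_norm_shift V (r : R) (x : nat -> V) N : 0 < r ->
  (weak_norm r (fun j => x (N + j)%N) <= weak_norm r x)%E.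
Proof.
move=> r0; apply: ge_ereal_sup => _ [f /= f1 <-].
apply: (@le_trans _ _ (lnorm r%:E (fun j => rnorm (f (x j))))).
  by apply: (@lnorm_shift _ _ (fun j => rnorm (f (x j)))).
by apply: ereal_sup_ubound; exists f.
Qed.

Lemma weak_norm_truncate V (r : R) (x : nat -> V) N : 0 < r ->
  (weak_norm r (truncate N x) <= weak_norm r x)%E.
Proof.
move=> r0; apply: ge_ereal_sup => _ [f /= f1 <-].
apply: (@le_trans _ _ (lnorm r%:E (fun j => rnorm (f (x j))))).
  apply: lnorm_le => // j; rewrite /truncate; case: ifP => // _.
  by rewrite cont_linear0 rnorm0 normr0.
by apply: ereal_sup_ubound; exists f.
Qed.

(** Feeds one vector, or one elementary tensor, into notions phrased for sequences. *)
Definition single (Z : nmodType) (z : Z) (j : nat) : Z := if j is 0%N then z else 0.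

Lemma rnorm_single (V : normedModType K) (v : V) :
  (fun j => rnorm (single v j)) = single (rnorm v).
Proof. by apply/funext => -[|j] /=; rewrite ?rnorm0. Qed.

Lemma lnorm_single_le (p : \bar R) (c : R) : (0 < p)%E ->
  (lnorm p (single c) <= `|c|%:E)%E.
Proof.
case: p => [p p0|_|//]; last first.
  by apply/lnormy_leP => -[|j]//; rewrite normr0.
apply/lnorm_le_sumP => // -[|N]; first by rewrite big_geq// powR_ge0.
rewrite big_nat_recl//= big1 ?addr0// => j _.
by rewrite normr0 powR0// gt_eqF.
Qed.

Lemma weak_norm_single V (r : R) (v : V) : 0 < r ->
  (weak_norm r (single v) <= (rnorm v)%:E)%E.
Proof.
move=> r0; apply/weak_norm_leP; rewrite ?rnorm_ge0// => f.
rewrite (_ : (fun j => _) = single (rnorm (f v))).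
  apply: le_trans (lnorm_single_le _ _) _ => //.
  by rewrite lee_fin ger0_norm ?rnorm_ge0// rnorm_cont_linear_le.
by apply/funext => -[|j]//; rewrite cont_linear0 rnorm0.
Qed.

(** Composing a functional with [T] gives a functional of norm at most M times larger. [T] is a
    plain map so that the error A - P A of an approximation P can be inserted directly. *)
Lemma weak_norm_apply V W (r : R) (x : nat -> V) (T : V -> W) (M w : R) :
  0 < r -> linear T -> (forall v, rnorm (T v) <= M * rnorm v) -> 0 <= M -> 0 <= w ->
  (weak_norm r x <= w%:E)%E -> (weak_norm r (fun j => T (x j)) <= (M * w)%:E)%E.
Proof.
move=> r0 lT TM M0 w0 /(weak_norm_leP _ r0 w0) xw.
apply/weak_norm_leP => //; first exact: mulr_ge0.
move=> f; have [|v|g gE] := @cont_linear_exists R k V K^o (fun v => f (T v)) (rnorm f * M).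
- by move=> a u v; rewrite lT cont_linearD cont_linearZ.
- by rewrite (le_trans (rnorm_cont_linear_le _ _))// -mulrA ler_wpM2l ?rnorm_ge0.
rewrite (_ : (fun j => _) = fun j => rnorm (g (x j))); last first.
  by apply/funext => j; rewrite gE.
apply: le_trans (xw g) _; rewrite lee_fin mulrA ler_wpM2r//.
apply: rnorm_cont_linear_ge => [|v]; first by rewrite mulr_ge0 ?rnorm_ge0.
by rewrite gE (le_trans (rnorm_cont_linear_le _ _))// -mulrA ler_wpM2l ?rnorm_ge0.
Qed.

(** The summing inequality is tested on a one-term family. Pairing with [single 1] in [hoelder_sum]
    then reads off the zeroth coordinate, for finite and infinite conjugate exponents alike. *)
Lemma summing_bound_continuous V W (s r : R) (u : V -> W) (C : R) :
  1 <= s -> 1 <= r -> summing_bound (hoelder_conjugate s%:E) r u C ->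
  forall v, rnorm (u v) <= C * rnorm v.
Proof.
move=> s1 r1 [C0 uC] v; have r0 : 0 < r by rewrite (lt_le_trans ltr01).
have := uC 1%N (fun=> v).
have -> : truncate 1 (fun=> v) = single v.
  by apply/funext => -[|j].
have CR : (C%:E * weak_norm r (single v) <= (C * rnorm v)%:E)%E.
  by rewrite EFinM lee_wpmul2l// weak_norm_single.
move=> /le_trans/(_ CR) h.
have h1 : (lnorm s%:E (single 1%R) <= 1%:E)%E.
  apply: le_trans (lnorm_single_le _ _) _; rewrite ?normr1//.
  by rewrite lte_fin (lt_le_trans ltr01).
have := hoelder_sum 1 s1 h1 h; rewrite big_nat1 mul1r normr1 mul1r.
exact/le_trans/ler_norm.
Qed.

Lemma summing_bound_sum V W (s r : R) (u : V -> W) (C : R) (l : nat -> R)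
    (x : nat -> V) (M w : R) N :
  1 <= s -> 0 < r -> summing_bound (hoelder_conjugate s%:E) r u C ->
  (lnorm s%:E l <= M%:E)%E -> (weak_norm r x <= w%:E)%E ->
  \sum_(0 <= j < N) `|l j| * rnorm (u (x j)) <= M * (C * w).
Proof.
move=> s1 r0 [C0 uC] lM xw.
have h : (lnorm (hoelder_conjugate s%:E) (truncate N (fun j => rnorm (u (x j)))) <= (C * w)%:E)%E.
  apply: le_trans (uC N x) _; rewrite EFinM lee_wpmul2l//.
  exact: le_trans (weak_norm_truncate _ _ r0) xw.
apply: le_trans (hoelder_sum N s1 lM h).
apply: ler_sum_nat => j /andP[_ jN].
by rewrite /truncate jN ler_wpM2l// ler_norm.
Qed.

(** This is where 1 <= 1/s + 1/r enters: the scalar sequence f(x_j), bounded in l_r, is bounded by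
    the same constant for the conjugate exponent of s, so Hölder's inequality applies. *)
Lemma weak_norm_sum V (s r : R) (l : nat -> R) (x : nat -> V) (M w : R)
    (f : cont_linear V K^o) N :
  1 <= s -> 1 <= r -> 1 <= s^-1 + r^-1 -> 0 <= w ->
  (lnorm s%:E l <= M%:E)%E -> (weak_norm r x <= w%:E)%E ->
  \sum_(0 <= j < N) `|l j| * rnorm (f (x j)) <= M * (rnorm f * w).
Proof.
move=> s1 r1 sr w0 lM xw; have r0 : 0 < r by rewrite (lt_le_trans ltr01).
have /lnorm_conjugate_le := (weak_norm_leP x r0 w0).1 xw f.
move=> /(_ _ s1 r1 sr) h; apply: le_trans (hoelder_sum N s1 lM h).
by apply: ler_sum => j _; rewrite ler_wpM2l// ler_norm.
Qed.

(* Turns the finitely many, possibly non-linear, coordinates in [finite_rank] into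
   continuous linear ones. *)
Lemma dual_reproducing V (l : seq V) :
  (forall g : V, g != 0 -> exists f : cont_linear V K^o, f g != 0) ->
  exists s : seq (cont_linear V K^o * V),
    forall w, w \in l -> w = \sum_(q <- s) q.1 w *: q.2.
Proof.
move=> sep; elim: l => [|w0 l [s sP]]; first by exists [::].
pose Q v := \sum_(q <- s) q.1 v *: q.2.
have [g0|g0] := eqVneq (w0 - Q w0) 0.
  exists s => w; rewrite inE => /predU1P[->|/sP//].
  by apply/eqP; rewrite -subr_eq0; apply/eqP.
have [f fg] := sep _ g0; set g := w0 - Q w0 in g0 fg.
(* [f0] sends v to f(v - Q v) / f(g). It vanishes wherever Q already reproduces v and equals 1 at
   [w0], so the new pair repairs [w0] without disturbing [l]. *)
pose f0 : cont_linear V K^o := (f g)^-1 *: (f - \sum_(q <- s) f q.2 *: q.1).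
have f0E v : f0 v = (f g)^-1 * f (v - Q v).
  have sumE (s' : seq (cont_linear V K^o * V)) :
      (\sum_(q <- s') f q.2 *: q.1 : cont_linear V K^o) v = f (\sum_(q <- s') q.1 v *: q.2).
    elim: s' => [|q s' IH]; first by rewrite !big_nil cont_linear0.
    rewrite !big_cons cont_linearD -IH cont_linearZ [X in _ = X + _]mulrC.
    by [].
  by rewrite (cont_linearB f v (Q v)) /Q -sumE.
exists ((f0, g) :: s) => w.
have -> : \sum_(q <- (f0, g) :: s) q.1 w *: q.2 = f0 w *: g + Q w by rewrite big_cons.
rewrite f0E inE => /predU1P[->|ws].
  by rewrite -/g mulVf// scale1r /g subrK.
have Qw : Q w = w by rewrite [RHS]sP.
by rewrite Qw subrr cont_linear0 mulr0 scale0r add0r.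
Qed.

End weak_norm_theory.

(** * Multilinear forms *)

Section multilinear_forms.
Context {R : realType} {k : base_field} {n : nat}.
Local Notation K := (scalars R k).
Variables (E : 'I_n -> normedModType K).
Local Notation X := (cont_multilinear E K^o).

Lemma rnorm_multi_norm (A : X) : rnorm A = multi_norm A.
Proof. exact: of_realK. Qed.

Lemma rnorm_multi_le (A : X) (M : R) :
  (forall x, unit_polyball x -> rnorm (A x) <= M) -> rnorm A <= M.
Proof.
by move=> AM; rewrite rnorm_multi_norm; apply: (sup_norm_le (unit_polyball0 E)).
Qed.

Lemma multi_sumE (N : nat) (T : nat -> X) x :
  (\sum_(0 <= j < N) T j) x = \sum_(0 <= j < N) T j x.
Proof.
elim: N => [|N IH]; first by rewrite !big_geq.
by rewrite !big_nat_recr//= -IH.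
Qed.

Lemma evaluation_exists (x : forall i, E i) : unit_polyball x ->
  exists2 f : cont_linear X K^o, rnorm f <= 1 & forall A, f A = A x.
Proof.
move=> x1.
have Ax (A : X) : rnorm (A x) <= 1 * rnorm A.
  by rewrite mul1r rnorm_multi_norm; apply: sup_norm_ub => //; exact: cont_multilinear_bounded.
have [|f fE] := @cont_linear_exists R k X K^o (fun A : X => A x) 1 _ Ax; first by [].
by exists f => //; apply: rnorm_cont_linear_ge => // v; rewrite fE.
Qed.

(** The norm is a supremum over the unit polyball, so evaluations at its points already separate. *)
Lemma multi_separating (A : X) : A != 0 -> exists f : cont_linear X K^o, f A != 0.
Proof.
move=> A0; apply: contrapT => h.
have A0x x : unit_polyball x -> A x = 0.
  move=> x1; have [f _ fE] := evaluation_exists x1.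
  by apply/eqP; rewrite -fE; apply/negPn/negP => fA; apply: h; exists f.
move/eqP: A0; apply; apply: rnorm0_eq0; apply/eqP; rewrite eq_le rnorm_ge0 andbT.
by apply: rnorm_multi_le => x /A0x ->; rewrite (@rnorm0 R k K^o).
Qed.

(* The partial sums converge in norm because pointwise their tails are bounded,
   uniformly on the unit polyball, through the evaluation functionals. *)
Lemma multi_series_cvg0 (s r : R) (l : nat -> K^o) (c : nat -> K^o)
    (T : nat -> X) (w m : R) :
  1 <= s -> 1 <= r -> 1 <= s^-1 + r^-1 -> 0 <= w ->
  (lnorm s%:E (fun j => rnorm (l j)) < +oo)%E -> (weak_norm r T <= w%:E)%E ->
  (forall j, rnorm (c j) <= m) ->
  (forall x, unit_polyball x ->
    series (fun j => l j * c j * T j x : K^o) @ \oo --> (0 : K^o)) ->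
  series (fun j => (l j * c j) *: T j) @ \oo --> (0 : X).
Proof.
move=> s1 r1 sr w0 lfin Tw cm S0; have r0 : 0 < r by rewrite (lt_le_trans ltr01).
have s0 : 0 < s by rewrite (lt_le_trans ltr01).
have m0 : 0 <= m by rewrite (le_trans (rnorm_ge0 _) (cm 0%N)).
apply/rnorm_cvgP => e e0.
have d0 : 0 < e / (m * w + 1) by rewrite divr_gt0// ltr_wpDl// mulr_ge0.
have [N0 N0P] := lnorm_tail s0 lfin d0.
exists N0 => N /N0P lN; rewrite sub0r rnormN; apply: rnorm_multi_le => x x1.
have [f f1 fE] := evaluation_exists x1.
rewrite /series/= multi_sumE; apply/ler_addgt0Pr => d dd.
(* The series at x sums to 0, so up to d the N-th partial sum is minus a block of the tail. The
   bound on that block is independent of x, whereas [N1] may depend on x. *)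
have [N1 N1P] := (rnorm_cvgP _ _).1 (S0 x x1) _ dd.
have := N1P (N + N1)%N (leq_addl _ _); rewrite sub0r rnormN /series/=.
rewrite sum_addn.
set a := \sum_(0 <= _ < N) _; set b := \sum_(0 <= _ < N1) _ => ab.
rewrite -[a](addrK b); apply: le_trans (ler_rnormD _ _) _; rewrite rnormN addrC lerD//.
rewrite /b; apply: le_trans (ler_rnorm_sum _ _) _.
have h := weak_norm_sum f N1 s1 r1 sr w0 lN (le_trans (weak_norm_shift T N r0) Tw).
apply: (@le_trans _ _ (m * (e / (m * w + 1) * (rnorm f * w)))); last first.
  have h1 : m * (rnorm f * w) <= m * w by rewrite ler_wpM2l// ler_piMl.
  have -> : m * (e / (m * w + 1) * (rnorm f * w)) =
      e * (m * (rnorm f * w) / (m * w + 1)) by ring.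
  rewrite ler_piMr ?(ltW e0)// ler_pdivrMr ?ltr_wpDl ?mulr_ge0// mul1r; lra.
apply: le_trans (ler_wpM2l m0 h); rewrite mulr_sumr; apply: ler_sum => j _.
rewrite -[_ * _]/((l (N + j)%N * c (N + j)%N) *: T (N + j)%N x) rnormZ.
rewrite -[l _ * _]/(l (N + j)%N *: c (N + j)%N) rnormZ fE.
by rewrite ger0_norm ?rnorm_ge0// mulrA ler_wpM2r ?rnorm_ge0// mulrC ler_wpM2r ?rnorm_ge0.
Qed.

End multilinear_forms.

(** * Pairing a summing map with a representation *)

Section pairing.
Context {R : realType} {k : base_field} {n : nat}.
Local Notation K := (scalars R k).
Variables (s r : R) (s1 : 1 <= s) (r1 : 1 <= r) (sr : 1 <= s^-1 + r^-1).
Variables (E : 'I_n -> normedModType K) (F : normedModType K).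
Local Notation X := (cont_multilinear E K^o).
Implicit Types (u : X -> cont_linear F K^o) (l : nat -> K^o).
Implicit Types (T : nat -> X) (y : nat -> F).

Let s0 : 0 < s. Proof. by rewrite (lt_le_trans ltr01). Qed.
Let r0 : 0 < r. Proof. by rewrite (lt_le_trans ltr01). Qed.

Lemma rnormM (a b : K^o) : rnorm (a * b : K^o) = rnorm a * rnorm b.
Proof. exact: rnormZ. Qed.

(** Terms of the series that a functional with transform [u] must take as its value on the sum of
    the l_j T_j (x) y_j. *)
Definition pairing u l T y : nat -> K^o := fun j => l j * u (T j) (y j).

Lemma pairing_sum_le u C l T y (M w m : R) N :
  summing_bound (hoelder_conjugate s%:E) r u C ->
  (lnorm s%:E (fun j => rnorm (l j)) <= M%:E)%E -> (weak_norm r T <= w%:E)%E ->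
  0 <= m -> (forall j, rnorm (y j) <= m) ->
  \sum_(0 <= j < N) rnorm (pairing u l T y j) <= M * (C * w) * m.
Proof.
move=> uC lM Tw m0 ym.
have h := summing_bound_sum N s1 r0 uC lM Tw.
apply: (@le_trans _ _ (\sum_(0 <= j < N) `|rnorm (l j)| * rnorm (u (T j)) * m)).
  apply: ler_sum => j _; rewrite rnormM ger0_norm ?rnorm_ge0// -mulrA ler_wpM2l ?rnorm_ge0//.
  by rewrite (le_trans (rnorm_cont_linear_le _ _))// ler_wpM2l ?rnorm_ge0.
by rewrite -mulr_suml ler_wpM2r.
Qed.

(** The l_s-norms of the tails of [l] provide the Cauchy modulus: [pairing_sum_le], applied to the
    shifted sequences, controls every block that starts at N. *)
Lemma pairing_cvg u C l T y (M w m : R) :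
  summing_bound (hoelder_conjugate s%:E) r u C ->
  (lnorm s%:E (fun j => rnorm (l j)) <= M%:E)%E ->
  0 <= w -> (weak_norm r T <= w%:E)%E ->
  0 <= m -> (forall j, rnorm (y j) <= m) ->
  exists2 v : K^o, series (pairing u l T y) @ \oo --> v & rnorm v <= M * (C * w) * m.
Proof.
move=> uC lM w0 Tw m0 ym; have C0 : 0 <= C by case: uC.
have lfin : (lnorm s%:E (fun j => rnorm (l j)) < +oo)%E by rewrite (le_lt_trans lM)// ltry.
pose L N := fine (lnorm s%:E (fun j => rnorm (l (N + j)%N))).
have LE N : (L N)%:E = lnorm s%:E (fun j => rnorm (l (N + j)%N)).
  rewrite fineK// ge0_fin_numE ?lnorm_ge0//; apply: le_lt_trans lfin.
  by apply: (@lnorm_shift _ _ (fun j => rnorm (l j))); rewrite lte_fin.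
pose D := C * w * m + 1.
have D0 : 0 < D by rewrite ltr_wpDl// !mulr_ge0.
have [N N' NN'|e e0|v zv] := @scalar_cauchy R k (series (pairing u l T y))
  (fun N => L N * (C * w) * m).
- rewrite -(subnKC NN') /series/= sum_addn addrAC subrr add0r.
  apply: le_trans (ler_rnorm_sum _ _) _.
  apply: (@pairing_sum_le u C (fun j => l (N + j)%N) (fun j => T (N + j)%N)
    (fun j => y (N + j)%N)) => //.
    by rewrite LE.
  exact: le_trans (weak_norm_shift _ _ _) Tw.
- have [N0 /(_ N0 (leqnn _))] := lnorm_tail s0 lfin (divr_gt0 e0 D0).
  rewrite -LE lee_fin => LN; exists N0; rewrite -mulrA.
  apply: (@le_trans _ _ (e / D * (C * w * m))); first by rewrite ler_wpM2r// !mulr_ge0.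
  by rewrite -mulrA ler_piMr ?(ltW e0)// mulrC ler_pdivrMr// mul1r /D; lra.
exists v => //; apply/ler_addgt0Pr => e e0.
have [N0 /(_ N0 (leqnn _)) vz] := (rnorm_cvgP _ _).1 zv _ e0.
rewrite -[v](subrK (series (pairing u l T y) N0)) addrC.
rewrite (le_trans (ler_rnormD _ _))// lerD//.
apply: le_trans (ler_rnorm_sum _ _) _; exact: pairing_sum_le.
Qed.

(** Makes the three factors real numbers; for the weak norm this rests on uniform boundedness. *)
Lemma hn_representation_bounds (A : cont_multilinear E F) l T y :
  hn_representation s r A l T y ->
  exists M w m : R, [/\ [/\ 0 <= M, 0 <= w & 0 <= m],
    lnorm s%:E (fun j => rnorm (l j)) = M%:E, weak_norm r T = w%:E,
    lnorm +oo%E (fun j => rnorm (y j)) = m%:E & forall j, rnorm (y j) <= m].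
Proof.
move=> [ls Ts ys _].
have [w w0 Tw] := weakly_summable_fin r1 Ts.
have lE : (lnorm s%:E (fun j => rnorm (l j))) \is a fin_num by rewrite ge0_fin_numE ?lnorm_ge0.
have yE : (lnorm +oo%E (fun j => rnorm (y j))) \is a fin_num by rewrite ge0_fin_numE ?lnorm_ge0.
exists (fine (lnorm s%:E (fun j => rnorm (l j)))), w.
exists (fine (lnorm +oo%E (fun j => rnorm (y j)))).
split; rewrite ?fineK//; first by split=> //; rewrite fine_ge0 ?lnorm_ge0.
move=> j; rewrite -[rnorm _]ger0_norm ?rnorm_ge0//; move: j; apply/lnormy_leP.
by rewrite fineK.
Qed.

Lemma finite_rank_pairing_cvg0 u (P : cont_linear X X) l T y :
  linear u -> finite_rank P -> hn_representation s r (0 : cont_multilinear E F) l T y ->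
  series (pairing u l (fun j => P (T j)) y) @ \oo --> (0 : K^o).
Proof.
move=> lu [m [v Pv]] rep.
have [M [w [b [[M0 w0 b0] lM Tw yb yj]]]] := hn_representation_bounds rep.
pose U : {linear X -> cont_linear F K^o} := HB.pack u (GRing.isLinear.Build _ _ _ _ _ lu).
have uZ c A : u (c *: A) = c *: u A by exact: (linearZ_LR U).
have [sq sqP] := @dual_reproducing R k X [seq v i | i <- enum 'I_m] (@multi_separating R k n E).
(* The vectors spanning the range of P are reproduced by the pairs in [sq], hence so is P A, now
   with continuous linear coordinates. *)
have PE A : P A = \sum_(q <- sq) q.1 (P A) *: q.2.
  have [c ->] := Pv A.
  have {1}-> : \sum_(i < m) c i *: v i =
      \sum_(i < m) c i *: \sum_(q <- sq) q.1 (v i) *: q.2.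
    by apply: eq_bigr => i _; rewrite -sqP// map_f// mem_enum.
  under eq_bigr do rewrite scaler_sumr.
  rewrite exchange_big/=; apply: eq_bigr => q _.
  under eq_bigr do rewrite scalerA.
  rewrite -scaler_suml; congr (_ *: _).
  elim/big_ind2 : _ => [|_ a _ b' -> ->|i _]; rewrite ?cont_linear0 ?cont_linearD//.
  by rewrite cont_linearZ.
pose S (q : cont_linear X K^o * X) := series (fun j => (l j * u q.2 (y j)) *: T j).
have S0 q : S q @ \oo --> (0 : X).
  apply: (@multi_series_cvg0 R k n E s r l (fun j => u q.2 (y j)) T w (rnorm (u q.2) * b)) => //.
  - by rewrite lM ltry.
  - by rewrite Tw.
  - by move=> j; rewrite (le_trans (rnorm_cont_linear_le _ _))// ler_wpM2l ?rnorm_ge0.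
  (* Applying the functional [u q.2] to the representation of 0 at x gives the required scalar
     series with sum 0. *)
  move=> x _; have [_ _ _ /(_ x) rx] := rep.
  have [_ /(_ (0 : F)) cu] := cont_linearP (u q.2).
  have := cvg_comp _ _ rx cu; rewrite cont_linear0; apply: cvg_trans.
  apply: near_eq_cvg; apply: nearW => N /=.
  rewrite /series/= cont_linear_sum; apply: eq_bigr => j _.
  rewrite !cont_linearZ -[LHS]/(l j * (T j x * u q.2 (y j))); ring.
(* Exchanging the finite sum over q with the partial sum over j leaves continuous functionals of the
   null sequences [S q]. *)
have -> : series (pairing u l (fun j => P (T j)) y) =
    fun N => \sum_(q <- sq) q.1 (P (S q N)).
  apply/funext => N; rewrite /series/= /S/series/=.
  under [RHS]eq_bigr do rewrite !cont_linear_sum.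
  rewrite exchange_big/=; apply: eq_bigr => j _; rewrite /pairing {1}PE.
  rewrite -[u]/(U : X -> _) linear_sum/=.
  have -> (t : seq (cont_linear X K^o * X)) :
      (\sum_(q <- t) u (q.1 (P (T j)) *: q.2)) (y j) =
      \sum_(q <- t) q.1 (P (T j)) * u q.2 (y j).
    elim: t => [|q t IH]; first by rewrite !big_nil.
    by rewrite !big_cons -IH uZ.
  rewrite mulr_sumr; apply: eq_bigr => q _.
  rewrite !cont_linearZ -[RHS]/(l j * u q.2 (y j) * q.1 (P (T j))); ring.
have qPS (q : cont_linear X K^o * X) : (fun N => q.1 (P (S q N))) @ \oo --> (0 : K^o).
  have cP : P x @[x --> (0 : X)] --> (0 : X).
    by rewrite -[X in _ --> X](cont_linear0 P); exact: (cont_linearP P).2.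
  have cq : q.1 x @[x --> (0 : X)] --> (0 : K^o).
    by rewrite -[X in _ --> X](cont_linear0 q.1); exact: (cont_linearP q.1).2.
  exact: cvg_comp (cvg_comp _ _ (S0 q) cP) cq.
elim: {sqP PE}sq => [|q t IH].
  by apply: cvg_near_cst; apply: nearW => N; rewrite big_nil.
rewrite (_ : (fun N => _) = (fun N => q.1 (P (S q N)) + \sum_(q <- t) q.1 (P (S q N)))).
  by rewrite -[X in _ --> X](addr0 (0 : K^o)); apply: cvgD.
by apply/funext => N; rewrite big_cons.
Qed.

Lemma pairing_zero u C l T y :
  bounded_approximation_property X ->
  linear u -> summing_bound (hoelder_conjugate s%:E) r u C ->
  hn_representation s r (0 : cont_multilinear E F) l T y ->
  series (pairing u l T y) @ \oo --> (0 : K^o).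
Proof.
move=> [lam bap] lu uC rep; have C0 : 0 <= C by case: uC.
have [M [w [m [[M0 w0 m0] lM Tw _ ym]]]] := hn_representation_bounds rep.
pose U : {linear X -> cont_linear F K^o} := HB.pack u (GRing.isLinear.Build _ _ _ _ _ lu).
have lfin : (lnorm s%:E (fun j => rnorm (l j)) < +oo)%E by rewrite lM ltry.
apply/rnorm_cvgP => e e0.
have e30 : 0 < e / 3 by rewrite divr_gt0.
pose D := C * ((1 + `|lam|) * w) * m + 1.
have D0 : 0 < D by rewrite ltr_wpDl// !mulr_ge0// addr_ge0.
(* [N0] is fixed before P: the tail bound sees P only through |lam|. The approximation then concerns
   only T_0, ..., T_(N0-1), a finite and therefore compact set, and accuracy e/3/D' makes their
   total error at most e/3. *)
have [N0 /(_ N0 (leqnn _)) lN0] := lnorm_tail s0 lfin (divr_gt0 e30 D0).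
pose D' := (\sum_(0 <= j < N0) rnorm (l j)) * C * m + 1.
have sl0 : 0 <= \sum_(0 <= j < N0) rnorm (l j) by rewrite sumr_ge0// => *; exact: rnorm_ge0.
have D'0 : 0 < D' by rewrite ltr_wpDl// !mulr_ge0.
have cQ : compact [set T j | j in `I_N0].
  by apply: finite_compact; apply: finite_image; exact: finite_II.
have [P [Pfin Plam PT]] := bap _ _ cQ (divr_gt0 e30 D'0).
have [N1 N1P] := (rnorm_cvgP _ _).1 (finite_rank_pairing_cvg0 lu Pfin rep) _ e30.
pose T' j := T j - P (T j).
have T'w : (weak_norm r T' <= ((1 + `|lam|) * w)%:E)%E.
  apply: (@weak_norm_apply R k X X r T (fun A => A - P A)) => //.
  - move=> a A B; rewrite cont_linearD cont_linearZ scalerBr opprD.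
    by rewrite addrACA.
  - move=> A; rewrite (le_trans (ler_rnormD _ _))// rnormN mulrDl mul1r lerD2l.
    rewrite (le_trans (rnorm_cont_linear_le _ _))// ler_wpM2r ?rnorm_ge0//.
    by rewrite (le_trans Plam)// ler_norm.
  - by rewrite Tw.
exists (maxn N0 N1) => N; rewrite geq_max => /andP[NN0 NN1].
rewrite sub0r rnormN.
have -> : series (pairing u l T y) N =
    series (pairing u l T' y) N + series (pairing u l (fun j => P (T j)) y) N.
  rewrite /series/= -big_split/=; apply: eq_bigr => j _.
  by rewrite /pairing -mulrDr; congr (_ * _); rewrite /T' -[u]/(U : X -> _) linearB/= subrK.
apply: le_trans (ler_rnormD _ _) _.
(* In order: the first [N0] error terms, the tail of the error terms, and the finite-rank series. *)
have -> : e = e / 3 + e / 3 + e / 3 by field.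
apply: lerD; last by have := N1P N NN1; rewrite sub0r rnormN.
rewrite -(subnKC NN0) /series/= sum_addn (le_trans (ler_rnormD _ _))// lerD//.
  apply: le_trans (ler_rnorm_sum _ _) _.
  apply: (@le_trans _ _ (\sum_(0 <= j < N0) rnorm (l j) * (C * (e / 3 / D') * m))).
    apply: ler_sum_nat => j /andP[_ jN0]; rewrite rnormM ler_wpM2l ?rnorm_ge0//.
    rewrite (le_trans (rnorm_cont_linear_le _ _))// ler_pM ?rnorm_ge0//.
    rewrite (le_trans (summing_bound_continuous s1 r1 uC _))// ler_wpM2l//.
    by rewrite rnormB; apply: PT; exists j.
  rewrite -mulr_suml.
  have -> : (\sum_(0 <= j < N0) rnorm (l j)) * (C * (e / 3 / D') * m) =
      e / 3 * ((D' - 1) / D').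
    by rewrite /D'; ring.
  by rewrite ler_piMr ?(ltW e30)// ler_pdivrMr// mul1r; lra.
apply: le_trans (ler_rnorm_sum _ _) _.
apply: (@le_trans _ _ (e / 3 / D * (C * ((1 + `|lam|) * w)) * m)).
  apply: (@pairing_sum_le u C (fun j => l (N0 + j)%N) (fun j => T' (N0 + j)%N)
    (fun j => y (N0 + j)%N)) => //.
  exact: le_trans (weak_norm_shift _ _ _) T'w.
have -> : e / 3 / D * (C * ((1 + `|lam|) * w)) * m = e / 3 * ((D - 1) / D) by rewrite /D; ring.
by rewrite ler_piMr ?(ltW e30)// ler_pdivrMr// mul1r; lra.
Qed.

End pairing.

(** * Duality *)

Section hyper_nuclear_duality.
Context {R : realType} {k : base_field} {n : nat}.
Local Notation K := (scalars R k).
Variables (s r : R) (s1 : 1 <= s) (r1 : 1 <= r) (sr : 1 <= s^-1 + r^-1).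
Variables (E : 'I_n -> normedModType K) (F : normedModType K).
Local Notation X := (cont_multilinear E K^o).
Local Notation HN := (hyper_nuclear s r E F).

Let s0 : 0 < s. Proof. by rewrite (lt_le_trans ltr01). Qed.
Let r0 : 0 < r. Proof. by rewrite (lt_le_trans ltr01). Qed.

(** An almost norming vector is multiplied by a scalar of modulus 1 that makes its value real and
    nonnegative, so that such values add up without cancellation. *)
Lemma norming_vector (g : cont_linear F K^o) (e : R) : 0 < e ->
  exists y, rnorm y <= 1 /\ exists2 t : R, rnorm g - e <= t & g y = of_real t.
Proof.
move=> e0; have hs : has_sup [set rnorm (g x) | x in @unit_ball R k F].
  split; first by have [x x1] := @unit_ball0 R k F; exists (rnorm (g x)), x.
  have [M gM] := cont_linear_bounded g.
  by exists M => _ [x x1 <-]; exact: gM.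
have [_ [y /= y1 <-] gy] := sup_adherent e0 hs.
have ry1 : rnorm y <= 1 by rewrite -(@ler_of_real R k) of_real_rnorm of_real1.
have {}gy : rnorm g - e < rnorm (g y) by rewrite rnorm_op_norm.
have [gy0|gy0] := eqVneq (g y) 0.
  exists y; split => //; exists 0; rewrite ?gy0 ?of_real0//.
  by rewrite ltW// (lt_le_trans gy)// gy0 rnorm0.
have rgy0 : rnorm (g y) != 0 by apply: contra_neq gy0; exact: (@rnorm0_eq0 _ _ K^o).
pose c : K := of_real (rnorm (g y)) * (g y)^-1.
have c1 : rnorm (c : K^o) = 1.
  by rewrite rnormM rnorm_of_real ger0_norm ?rnorm_ge0// rnormV// mulfV.
exists (c *: y); split; first by rewrite rnormZ c1 mul1r.
exists (rnorm (g y)); first exact: ltW.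
by rewrite cont_linearZ -[LHS]/(c * g y) -mulrA mulVf// mulr1.
Qed.

(** The interleaved representation is kept explicit so that the pairing series can be evaluated
    along it. *)
Lemma hn_representation_lin c (A B : cont_multilinear E F) l1 T1 y1 l2 T2 y2 :
  hn_representation s r A l1 T1 y1 -> hn_representation s r B l2 T2 y2 ->
  hn_representation s r (c *: A + B) (interleave (fun j => c *: l1 j) l2)
    (interleave T1 T2) (interleave y1 y2).
Proof.
move=> [l1s T1s y1s A1] [l2s T2s y2s B2]; split.
- rewrite (map_interleave (@rnorm _ _ K^o)); apply: lnorm_interleave => //=.
  rewrite (_ : (fun j => rnorm _) = fun j => `|rnorm (c : K^o)| * rnorm (l1 j)).
    exact: lnormZ_lty.
  by apply/funext => j /=; rewrite rnormZ ger0_norm ?rnorm_ge0.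
- move=> f; rewrite (map_interleave (fun T => rnorm (f T))).
  by apply: lnorm_interleave; [|exact: T1s|exact: T2s].
- by rewrite (map_interleave (@rnorm _ _ F)); exact: lnorm_interleave.
- move=> x; rewrite -[X in _ --> X]/(c *: A x + B x).
  rewrite (_ : (fun j => _) = interleave (fun j => c *: (l1 j *: (T1 j x *: y1 j)))
     (fun j => l2 j *: (T2 j x *: y2 j))); last first.
    by apply/funext => j; rewrite /interleave; case: ifP => // _; rewrite [RHS]scalerA.
  apply: series_interleave; last exact: B2.
  rewrite (_ : series _ = c \*: series (fun j => l1 j *: (T1 j x *: y1 j))).
    exact: cvgZl_tmp (A1 x).
  by apply/funext => N; rewrite /series/= scaler_sumr.
Qed.

Lemma hn_norm_le (A : cont_multilinear E F) l T y (M w m : R) :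
  hn_representation s r A l T y ->
  (lnorm s%:E (fun j => rnorm (l j)) <= M%:E)%E -> (weak_norm r T <= w%:E)%E ->
  0 <= m -> (forall j, rnorm (y j) <= m) ->
  (hn_norm s r A <= (M * w * m)%:E)%E.
Proof.
move=> rep lM Tw m0 ym.
apply: (@le_trans _ _ (lnorm s%:E (fun j => rnorm (l j)) * weak_norm r T *
         lnorm +oo (fun j => rnorm (y j)))%E).
  by apply: ereal_inf_lbound; exists l, T, y.
rewrite !EFinM lee_pmul ?mule_ge0 ?lnorm_ge0 ?weak_norm_ge0//.
  by rewrite lee_pmul ?lnorm_ge0 ?weak_norm_ge0.
by apply/lnormy_leP => j; rewrite ger0_norm ?rnorm_ge0.
Qed.

(** The infimum in the hyper-nuclear norm may not be attained; a representation with product below 1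
    + e/(C+1) costs at most e more. *)
Lemma hn_dual_norm_le (phi : HN -> K^o) (C : R) : 0 <= C ->
  (forall (A : HN) l T y (M w m : R), hn_representation s r A l T y ->
    (lnorm s%:E (fun j => rnorm (l j)) <= M%:E)%E -> 0 <= w -> (weak_norm r T <= w%:E)%E ->
    0 <= m -> (forall j, rnorm (y j) <= m) -> rnorm (phi A) <= M * (C * w) * m) ->
  (hn_dual_norm phi <= C%:E)%E.
Proof.
move=> C0 phiC; apply: ge_ereal_sup => _ [A /= A1 <-].
rewrite lee_fin; apply/ler_addgt0Pr => e e0.
have C10 : 0 < C + 1 by rewrite ltr_wpDl.
have Ae : (hn_norm s r A < (1 + e / (C + 1))%:E)%E.
  by rewrite (le_lt_trans A1)// lte_fin ltrDl divr_gt0.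
have [_ [l [T [y [rep ->]]]] lt1] := ereal_inf_lt Ae.
have [M [w [m [[M0 w0 m0] lM Tw yE ym]]]] := hn_representation_bounds r1 rep.
move: lt1; rewrite lM Tw yE -!EFinM lte_fin => lt1.
have := phiC A l T y M w m rep; rewrite lM Tw !lexx => /(_ isT w0 isT m0 ym) h.
apply: (le_trans h); have -> : M * (C * w) * m = C * (M * w * m) by ring.
apply: (@le_trans _ _ (C * (1 + e / (C + 1)))); first by rewrite ler_wpM2l// ltW.
rewrite mulrDr mulr1 lerD2l mulrCA ler_piMr ?(ltW e0)//.
by rewrite ler_pdivrMr// mul1r lerDl.
Qed.

Lemma weakly_summable_truncate (T : nat -> X) N : weakly_summable r (truncate N T).
Proof.
move=> f; pose S := \sum_(0 <= j < N) `|rnorm (f (T j))| `^ r.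
have S0 : 0 <= S by rewrite sumr_ge0// => *; exact: powR_ge0.
apply: (@le_lt_trans _ _ (S `^ r^-1)%:E); last by rewrite ltry.
rewrite (_ : (fun j => _) = truncate N (fun j => rnorm (f (T j)))); last first.
  by apply/funext => j; rewrite /truncate; case: ifP => // _; rewrite cont_linear0 rnorm0.
apply: lnorm_truncate_le => //; first exact: powR_ge0.
by rewrite -powRrM mulVf ?gt_eqF// powRr1.
Qed.

Lemma hn_sumE (N : nat) (A : nat -> HN) x :
  (\sum_(0 <= j < N) A j : HN) x = \sum_(0 <= j < N) A j x.
Proof.
elim: N => [|N IH]; first by rewrite !big_geq.
by rewrite !big_nat_recr//= -IH.
Qed.

Lemma series_single_cvg (V : normedModType K) (u : nat -> V) :
  (forall j, u j.+1 = 0) -> series u @ \oo --> u 0%N.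
Proof.
move=> u0; rewrite -(@cvg_shiftS _); apply: cvg_near_cst; apply: nearW => N.
by rewrite /series/= big_nat_recl//= big1 ?addr0.
Qed.

Lemma hn_tensor_representation (A : X) (y : F) :
  hn_representation s r (tensor A y) (single (1 : K^o)) (single A) (single y).
Proof.
split.
- by rewrite (rnorm_single (1 : K^o)); exact: lnorm_single_lty.
- move=> f; rewrite (_ : (fun j => _) = single (rnorm (f A))); first exact: lnorm_single_lty.
  by apply/funext => -[|j]//=; rewrite cont_linear0 rnorm0.
- by rewrite rnorm_single; exact: lnorm_single_lty.
- move=> x; rewrite -[tensor A y x]scale1r.
  apply: (@series_single_cvg F (fun j => single 1 j *: (single A j x *: single y j))).
  by move=> j; rewrite scale0r.
Qed.

Lemma lnorm_single1 : (lnorm s%:E (fun j => rnorm (single (1 : K^o) j)) <= 1%:E)%E.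
Proof.
rewrite (rnorm_single (1 : K^o)) (le_trans (lnorm_single_le _ _))//.
by rewrite lee_fin rnorm1 normr1.
Qed.

Lemma rnorm_single_le (y : F) j : rnorm (single y j) <= rnorm y.
Proof. by case: j => [|j] //=; rewrite rnorm0 rnorm_ge0. Qed.

(** * The Borel transform of a single functional *)

Section dual_element.
Variable phi : hn_dual s r E F.

Lemma hn_dualP : linear phi /\ (hn_dual_norm phi < +oo)%E.
Proof. exact: set_mem (valP phi). Qed.

Let philin : {linear HN -> K^o} := HB.pack (phi : HN -> K^o)
  (GRing.isLinear.Build _ _ _ _ _ hn_dualP.1).

Lemma hn_dualZ c (A : HN) : phi (c *: A) = c *: phi A.
Proof. exact: (linearZ_LR philin). Qed.

Lemma hn_dualB (A B : HN) : phi (A - B) = phi A - phi B.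
Proof. exact: (linearB philin). Qed.

Lemma hn_dual_sum N (A : nat -> HN) :
  phi (\sum_(0 <= j < N) A j) = \sum_(0 <= j < N) phi (A j).
Proof. exact: (linear_sum philin). Qed.

Lemma hn_dual_norm_ge0 : (0 <= hn_dual_norm phi)%E.
Proof.
apply: (@le_trans _ _ (rnorm (phi (hn_tensor s r 0 0)))%:E); first by rewrite lee_fin rnorm_ge0.
apply: ereal_sup_ubound; exists (hn_tensor s r 0 0) => //=.
have := hn_norm_le (hn_tensor_representation 0 0) lnorm_single1
  (weak_norm_single _ r0) _ (rnorm_single_le _).
by move=> /(_ (rnorm_ge0 _))/le_trans; apply; rewrite lee_fin !rnorm0 mulr0.
Qed.

Let D := fine (hn_dual_norm phi).

Lemma hn_dual_norm_fineE : hn_dual_norm phi = D%:E.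
Proof. by rewrite fineK// ge0_fin_numE ?hn_dual_norm_ge0//; exact: hn_dualP.2. Qed.

Let D0 : 0 <= D. Proof. by rewrite fine_ge0// hn_dual_norm_ge0. Qed.

Lemma hn_dual_le (A : HN) l T y (M w m : R) :
  hn_representation s r A l T y ->
  (lnorm s%:E (fun j => rnorm (l j)) <= M%:E)%E -> 0 <= w -> (weak_norm r T <= w%:E)%E ->
  0 <= m -> (forall j, rnorm (y j) <= m) -> rnorm (phi A) <= D * (M * w * m).
Proof.
move=> rep lM w0 Tw m0 ym.
have M0 : 0 <= M by rewrite -lee_fin (le_trans (lnorm_ge0 _ _) lM).
(* Division by t puts A in the unit ball; the strict inequality keeps t positive even when the
   product is 0. *)
have scale (t : R) : M * w * m < t -> rnorm (phi A) <= D * t.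
  move=> Mt; have t0 : 0 < t by rewrite (le_lt_trans _ Mt)// !mulr_ge0.
  have ti0 : 0 <= t^-1 by rewrite invr_ge0 ltW.
  pose c : K := of_real t^-1.
  have rc : rnorm (c : K^o) = t^-1 by rewrite rnorm_of_real ger0_norm.
  have lcM : (lnorm s%:E (fun j => rnorm (c *: l j)) <= (t^-1 * M)%:E)%E.
    rewrite (_ : (fun j => _) = fun j => t^-1 * rnorm (l j)); last first.
      by apply/funext => j; rewrite rnormZ rc.
    by rewrite -{2}(ger0_norm ti0) lnormZ_le.
  have repc : hn_representation s r (c *: A : HN) (fun j => c *: l j) T y.
    have [_ Ts ys lx] := rep; split => // [|x].
      by rewrite (le_lt_trans lcM)// ltry.
    rewrite -[X in _ --> X]/(c *: A x).
    rewrite (_ : (fun j => _) = fun j => c *: (l j *: (T j x *: y j))); last first.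
      by apply/funext => j; rewrite [RHS]scalerA.
    rewrite (_ : series _ = c \*: series (fun j => l j *: (T j x *: y j))).
      exact: cvgZl_tmp (lx x).
    by apply/funext => N; rewrite /series/= scaler_sumr.
  have : (hn_norm s r (c *: A : HN) <= 1)%E.
    apply: le_trans (hn_norm_le repc lcM Tw m0 ym) _.
    rewrite lee_fin; have -> : t^-1 * M * w * m = (M * w * m) / t by ring.
    by rewrite ler_pdivrMr// mul1r ltW.
  move=> cA1; have : ((rnorm (phi (c *: A)))%:E <= hn_dual_norm phi)%E.
    by apply: ereal_sup_ubound; exists (c *: A).
  rewrite hn_dual_norm_fineE lee_fin hn_dualZ rnormZ rc.
  by rewrite ler_pdivrMl// mulrC.
apply/ler_addgt0Pr => e e0.
have D10 : 0 < D + 1 by rewrite ltr_wpDl.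
have lte : M * w * m < M * w * m + e / (D + 1) by rewrite ltrDl divr_gt0.
apply: le_trans (scale _ lte) _; rewrite mulrDr lerD2l mulrCA ler_piMr ?(ltW e0)//.
by rewrite ler_pdivrMr// mul1r lerDl.
Qed.

Lemma hn_tensor_le (A : X) (y : F) : rnorm (phi (hn_tensor s r A y)) <= D * rnorm A * rnorm y.
Proof.
have rep : hn_representation s r (hn_tensor s r A y) _ _ _ :=
  hn_tensor_representation A y.
have := hn_dual_le rep lnorm_single1 (rnorm_ge0 A) (weak_norm_single A r0)
  (rnorm_ge0 y) (rnorm_single_le y).
by rewrite mul1r mulrA.
Qed.

Lemma hn_tensor_linearr (A : X) : linear (hn_tensor s r A : F -> HN).
Proof.
move=> a y z; apply/val_inj/val_inj/funext => x.
by rewrite -[LHS]/(A x *: (a *: y + z)) -[RHS]/(a *: (A x *: y) + A x *: z)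
  scalerDr !scalerA mulrC.
Qed.

Lemma hn_tensor_linearl (y : F) : linear (fun A : X => hn_tensor s r A y : HN).
Proof.
move=> a A B; apply/val_inj/val_inj/funext => x.
by rewrite -[LHS]/((a *: A x + B x) *: y) -[RHS]/(a *: (A x *: y) + B x *: y)
  scalerDl scalerA.
Qed.

Lemma borel_subproof (A : X) :
  (fun y => phi (hn_tensor s r A y)) \in @cont_linear_pred R k F K^o.
Proof.
apply: (@cont_linear_subproof R k F K^o _ (D * rnorm A)) => [a y z|y]; last exact: hn_tensor_le.
by rewrite hn_tensor_linearr; exact: (hn_dualP.1).
Qed.

Definition borel (A : X) : cont_linear F K^o := ContLinear (borel_subproof A).

Lemma borelE A y : borel A y = phi (hn_tensor s r A y).
Proof. by []. Qed.

Lemma borel_linear : linear borel.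
Proof.
move=> a A B; apply/val_inj/funext => y.
by rewrite -[LHS]/(phi (hn_tensor s r (a *: A + B) y)) hn_tensor_linearl hn_dualP.1.
Qed.

(* A minus the N-th partial sum of a representation is represented by the tail. *)
Lemma pairing_borel_cvg (A : HN) l T y : hn_representation s r A l T y ->
  series (pairing borel l T y) @ \oo --> phi A.
Proof.
move=> rep; have [M [w [m [[M0 w0 m0] lM Tw _ ym]]]] := hn_representation_bounds r1 rep.
have [ls Ts ys Ax] := rep.
apply/rnorm_cvgP => e e0.
have Q0 : 0 < D * w * m + 1 by rewrite ltr_wpDl// !mulr_ge0.
have [N0 N0P] := lnorm_tail s0 ls (divr_gt0 e0 Q0).
exists N0 => N /N0P lN.
pose AN : HN := A - \sum_(0 <= j < N) l j *: hn_tensor s r (T j) (y j).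
have -> : phi A - series (pairing borel l T y) N = phi AN.
  rewrite hn_dualB hn_dual_sum; congr (_ - _).
  by apply: eq_bigr => j _; rewrite hn_dualZ.
have repN : hn_representation s r AN (fun j => l (N + j)%N)
    (fun j => T (N + j)%N) (fun j => y (N + j)%N).
  split.
  - by rewrite (le_lt_trans lN)// ltry.
  - move=> f; apply: le_lt_trans (Ts f).
    by apply: (@lnorm_shift _ _ (fun j => rnorm (f (T j)))); rewrite lte_fin.
  - by apply: le_lt_trans ys; apply: (@lnorm_shift _ _ (fun j => rnorm (y j))).
  - move=> x; apply/rnorm_cvgP => d d0.
    have [N1 N1P] := (rnorm_cvgP _ _).1 (Ax x) _ d0.
    exists N1 => N' N1N'; have := N1P (N + N')%N (leq_trans N1N' (leq_addl _ _)).
    have -> : AN x = A x - \sum_(0 <= j < N) l j *: (T j x *: y j).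
      pose S : HN := \sum_(0 <= j < N) l j *: hn_tensor s r (T j) (y j).
      by rewrite -[LHS]/(A x - S x) hn_sumE.
    by rewrite /series/= sum_addn opprD addrA.
apply: le_trans (hn_dual_le repN lN w0 _ m0 _) _ => //.
  by rewrite (le_trans (weak_norm_shift _ _ r0))// Tw.
have -> : D * (e / (D * w * m + 1) * w * m) = e * (D * w * m / (D * w * m + 1)) by ring.
by rewrite ler_piMr ?(ltW e0)// ler_pdivrMr// mul1r; lra.
Qed.

(** By [hoelder_dual], it suffices to bound the sums of l_j |borel (T_j)| with l_j >= 0. With almost
    norming y_j in the unit ball, such a sum is up to e at most the value of [phi] on the finite sum
    of the l_j T_j (x) y_j, whose hyper-nuclear norm is at most M w. *)
Lemma borel_summing_bound : summing_bound (hoelder_conjugate s%:E) r borel D.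
Proof.
split=> // N T.
have [w w0 Tw] := weakly_summable_fin r1 (weakly_summable_truncate T N).
rewrite Tw -EFinM; apply: hoelder_dual => // [|l M l0 lM]; first exact: mulr_ge0.
have M0 : 0 <= M by rewrite -lee_fin (le_trans (lnorm_ge0 _ _) lM).
pose S := \sum_(0 <= j < N) l j.
have S0 : 0 <= S by exact: sumr_ge0.
apply/ler_addgt0Pr => e e0.
(* Weighted by the l_j, these slacks add up to at most e; the summand 1 covers S = 0. *)
have e1 : 0 < e / (S + 1) by rewrite divr_gt0// ltr_wpDl.
have [y yP] := choice (fun j => norming_vector (borel (T j)) e1).
have [t tP] := choice (fun j => let: ex_intro2 t h1 h2 := (yP j).2 in ex_intro _ t (conj h1 h2)).
pose A : HN := \sum_(0 <= j < N) of_real (l j) *: hn_tensor s r (T j) (y j).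
(* A representation is an infinite sequence, so the finite sum is padded by zeros. *)
pose l' j : K^o := of_real (truncate N l j).
have l'M : (lnorm s%:E (fun j => rnorm (l' j)) <= M%:E)%E.
  apply: le_trans lM; apply: lnorm_le => // j; rewrite rnorm_of_real normr_id /truncate.
  by case: ifP => // _; rewrite normr0.
have rep : hn_representation s r A l' (truncate N T) y.
  split.
  - by rewrite (le_lt_trans l'M)// ltry.
  - exact: weakly_summable_truncate.
  - apply: (@le_lt_trans _ _ 1%:E); last exact: ltry.
    by apply/lnormy_leP => j; rewrite ger0_norm ?rnorm_ge0//; case: (yP j).
  - move=> x; rewrite -(cvg_shiftn N).
    apply: cvg_near_cst; apply: nearW => N' /=.
    rewrite /series/= addnC sum_addn [X in _ + X]big1 ?addr0; last first.
      by move=> j _; rewrite /l' /truncate ltnNge leq_addr/= of_real0 scale0r.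
    rewrite hn_sumE; apply: eq_big_nat => j /andP[_ jN].
    by rewrite /l' /truncate jN.
have phiA : phi A = of_real (\sum_(0 <= j < N) l j * t j).
  rewrite hn_dual_sum.
  rewrite (big_morph _ (@of_realD R k) (@of_real0 R k)); apply: eq_bigr => j _.
  by rewrite hn_dualZ -borelE (tP j).2 of_realM.
have h : \sum_(0 <= j < N) l j * t j <= M * (D * w).
  have := hn_dual_le rep l'M w0 _ ler01 (fun j => (yP j).1).
  rewrite Tw => /(_ (lexx _)); rewrite phiA rnorm_of_real mulr1 => h.
  by rewrite (le_trans (ler_norm _))// (le_trans h)// mulrCA.
apply: (@le_trans _ _ (\sum_(0 <= j < N) (l j * t j + l j * (e / (S + 1))))).
  apply: ler_sum => j _; rewrite -mulrDr ler_wpM2l// ger0_norm ?rnorm_ge0//.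
  by rewrite -lerBlDr; exact: (tP j).1.
rewrite big_split/= lerD// -mulr_suml -/S mulrCA ler_piMr ?(ltW e0)//.
by rewrite ler_pdivrMr ?ltr_wpDl// mul1r lerDl.
Qed.

(** The dual norm is itself a summing constant; conversely, every summing constant bounds [phi]
    along each representation, through the sum of the pairing series. *)
Lemma borel_norm : summing_norm (hoelder_conjugate s%:E) r borel = hn_dual_norm phi.
Proof.
apply/eqP; rewrite eq_le; apply/andP; split.
  rewrite hn_dual_norm_fineE; apply: ereal_inf_lbound; exists D => //.
  exact: borel_summing_bound.
apply: le_ereal_inf_tmp => _ [C uC <-].
apply: hn_dual_norm_le => [|A l T y M w m rep lM w0 Tw m0 ym]; first by case: uC.
have [v zv vle] := pairing_cvg s1 r1 uC lM w0 Tw m0 ym.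
suff -> : phi A = v by [].
exact: (cvg_unique (@norm_hausdorff K K^o) (pairing_borel_cvg rep) zv).
Qed.

End dual_element.

(** * Bijectivity of the Borel transform *)

Lemma borel_injective : injective borel.
Proof.
move=> phi psi e; apply/val_inj/funext => A.
have [l [T [y rep]]] := set_mem (valP A).
(* Along one representation of A, both functionals are the limit of the same pairing series. *)
have phiA := pairing_borel_cvg (phi := phi) rep; rewrite e in phiA.
exact: (cvg_unique (@norm_hausdorff K K^o) phiA (pairing_borel_cvg (phi := psi) rep)).
Qed.

Lemma borel_surjective (u : X -> cont_linear F K^o) :
  bounded_approximation_property X ->
  summing (hoelder_conjugate s%:E) r u -> exists phi, borel phi = u.
Proof.
move=> bap [lu [C uC]].
have C0 : 0 <= C by case: uC.
(* The functional starts as a relation between A and the sums of its pairing series over all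
   representations. Interleaving makes it linear, so single-valuedness reduces to A = 0, where the
   approximation property is used. *)
pose value (A : cont_multilinear E F) (v : K^o) := exists l T y,
  hn_representation s r A l T y /\ series (pairing u l T y) @ \oo --> v.
have value_lin c A B v w : value A v -> value B w -> value (c *: A + B) (c *: v + w).
  move=> [l1 [T1 [y1 [rep1 v1]]]] [l2 [T2 [y2 [rep2 v2]]]].
  exists (interleave (fun j => c *: l1 j) l2), (interleave T1 T2), (interleave y1 y2).
  split; first exact: hn_representation_lin.
  rewrite (_ : pairing u _ _ _ = interleave (fun j => c *: pairing u l1 T1 y1 j)
      (pairing u l2 T2 y2)); last first.
    apply/funext => j; rewrite /pairing /interleave; case: ifP => // _.
    by rewrite -[RHS]/(c * (l1 j./2 * _)) mulrA.
  apply: series_interleave => //.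
  rewrite (_ : series _ = c \*: series (pairing u l1 T1 y1)).
    exact: cvgZl_tmp v1.
  by apply/funext => N; rewrite /series/= scaler_sumr.
have value0 v : value 0 v -> v = 0.
  move=> [l [T [y [rep vl]]]].
  exact: (cvg_unique (@norm_hausdorff K K^o) vl (pairing_zero s1 r1 sr bap lu uC rep)).
have value_fun A v w : value A v -> value A w -> v = w.
  move=> Av Aw; have := value_lin (- 1) A A v w Av Aw.
  rewrite !scaleN1r !addNr => /value0/eqP.
  by rewrite addrC subr_eq0 => /eqP.
have value_ex (A : HN) : exists v, value A v.
  have [l [T [y rep]]] := set_mem (valP A).
  have [M [w [m [[M0 w0 m0] lM Tw _ ym]]]] := hn_representation_bounds r1 rep.
  have [||v vl _] := @pairing_cvg R k n s r s1 r1 E F u C l T y M w m uC _ w0 _ m0 ym.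
  - by rewrite lM.
  - by rewrite Tw.
  by exists v, l, T, y.
pose phi0 (A : HN) : K^o := sval (cid (value_ex A)).
have phi0P (A : HN) : value A (phi0 A) by rewrite /phi0; case: cid.
have phi_lin : linear phi0.
  move=> c A B; apply: (value_fun (c *: A + B : HN)); first exact: phi0P.
  exact: value_lin (phi0P A) (phi0P B).
have phi_fin : (hn_dual_norm phi0 < +oo)%E.
  apply: (@le_lt_trans _ _ C%:E); last exact: ltry.
  apply: hn_dual_norm_le => // A l T y M w m rep lM w0 Tw m0 ym.
  have [v zv vle] := pairing_cvg s1 r1 uC lM w0 Tw m0 ym.
  suff -> : phi0 A = v by [].
  by apply: (value_fun A); [exact: phi0P|exists l, T, y].
have phiP : phi0 \in @hn_dual_pred R k n s r E F by apply/mem_set; split.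
exists (HnDual phiP); apply/funext => A; apply/val_inj/funext => y.
apply: (value_fun (hn_tensor s r A y)); first exact: phi0P.
(* Along the one-term representation of the tensor the pairing series is u(A)(y). *)
exists (single (1 : K^o)), (single A), (single y); split; first exact: hn_tensor_representation.
rewrite (_ : \val (u A) y = pairing u (single (1 : K^o)) (single A) (single y) 0%N).
  by apply: series_single_cvg => j; exact: mul0r.
exact: (esym (mul1r _)).
Qed.

End hyper_nuclear_duality.

Theorem theorem3p5 (R : realType) (k : base_field) (s r : R)
  (s_ge1 : 1 <= s) (r_ge1 : 1 <= r) (sr : 1 <= s^-1 + r^-1)
  (n : nat) (n_gt0 : (0 < n)%N)
  (E : 'I_n -> completeNormedModType (scalars R k))
  (bapE : bounded_approximation_property
            (cont_multilinear E (scalars R k)^o))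
  (F : completeNormedModType (scalars R k)) :
  exists B : {linear hn_dual s r E F ->
      (cont_multilinear E (scalars R k)^o -> cont_linear F (scalars R k)^o)},
    [/\ forall phi A y, B phi A y = phi (hn_tensor s r A y),
        forall phi, summing_norm (hoelder_conjugate s%:E) r (B phi) =
                    hn_dual_norm phi &
        set_bij [set: hn_dual s r E F]
          (summing (hoelder_conjugate s%:E) r) B].
Proof.
have borel_lin : linear (@borel R k n s r s_ge1 r_ge1 E F).
  by move=> a phi psi; apply/funext => A; apply/val_inj.
pose B : {linear hn_dual s r E F ->
    (cont_multilinear E (scalars R k)^o -> cont_linear F (scalars R k)^o)} :=
  HB.pack (@borel R k n s r s_ge1 r_ge1 E F) (GRing.isLinear.Build _ _ _ _ _ borel_lin).
exists B.
split=> [//|phi|]; first exact: borel_norm.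
split=> [phi _|phi psi _ _|u su].
- split; first exact: borel_linear.
  by exists (fine (hn_dual_norm phi)); exact: borel_summing_bound.
- exact: borel_injective.
- by have [phi <-] := borel_surjective s_ge1 r_ge1 sr bapE su; exists phi.
Qed.
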